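(* The sequence classes $\mathrm{Rad}(\cdot)$ and $\mathrm{RAD}(\cdot)$ are multilinearly stable.
   Context: All Banach spaces are over a fixed field $\mathbb{K}=\mathbb{R}$ or $\mathbb{C}$. $\mathcal{L}(E_1,\ldots,E_n;F)$ is the Banach space of continuous $n$-linear operators $E_1\times\cdots\times E_n\to F$ with the usual sup norm. $(r_j)_{j=1}^\infty$ are the Rademacher functions on $[0,1]$. For a Banach space $E$: - $\mathrm{Rad}(E)$ is the Banach space of almost unconditionally summable $E$-valued sequences, i.e. sequences $(x_j)_{j=1}^\infty$ such that $\sum_j r_j(t)x_j$ converges in $E$ for almost every $t\in[0,1]$ (equivalently, $\sum_j r_jx_j$ converges in $L_2([0,1];E)$), with norm $\|(x_j)_{j=1}^\infty\|_{\mathrm{Rad}(E)}=\left(\int_0^1\left\|\sum_{j=1}^\infty r_j(t)x_j\right\|^2dt\right)^{1/2}$. - $\mathrm{RAD}(E)=\{(x_j)_{j=1}^\infty\in E^{\mathbb{N}}:\|(x_j)_{j=1}^\infty\|_{\mathrm{RAD}(E)}:=\sup_k\|(x_j)_{j=1}^k\|_{\mathrm{Rad}(E)}<+\infty\}$, where finite sequences are completed with zeros. A sequence class $X$ is a rule assigning to each Banach space $E$ a Banach space $X(E)$ of $E$-valued sequences containing all finite sequences, contained in the bounded sequences with sup norm $\le\|\cdot\|_{X(E)}$, and with canonical scalar unit sequences of norm one in $X(\mathbb{K})$; the rules $E\mapsto\mathrm{Rad}(E)$ and $E\mapsto\mathrm{RAD}(E)$ are sequence classes. A sequence class $X$ is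 multilinearly stable if for every $n\in\mathbb{N}$, all Banach spaces $E_1,\ldots,E_n,F$ and every $A\in\mathcal{L}(E_1,\ldots,E_n;F)$, one has $(A(x_j^1,\ldots,x_j^n))_{j=1}^\infty\in X(F)$ whenever $(x_j^m)_{j=1}^\infty\in X(E_m)$, $m=1,\ldots,n$, and the induced $n$-linear operator $\widehat A\colon X(E_1)\times\cdots\times X(E_n)\to X(F)$, $\widehat A((x_j^1)_j,\ldots,(x_j^n)_j)=(A(x_j^1,\ldots,x_j^n))_j$, satisfies $\|\widehat A\|=\|A\|$. *)

(* Defs.v *)
From HB Require Import structures.
From mathcomp Require Import all_boot all_order all_algebra.
From mathcomp Require Import complex.
From mathcomp Require Import all_classical all_reals all_analysis.

Set Implicit Arguments.
Unset Strict Implicit.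
Unset Printing Implicit Defensive.

Import Order.TTheory GRing.Theory Num.Theory.
Import numFieldNormedType.Exports.

Local Open Scope classical_set_scope.
Local Open Scope ring_scope.

Inductive scalars := RealScalars | ComplexScalars.

Definition scalar_field (R : realType) (k : scalars) : numFieldType :=
  match k with
  | RealScalars => R
  | ComplexScalars => R[i]
  end.

Definition scalar_re (R : realType) (k : scalars) : scalar_field R k -> R :=
  match k with
  | RealScalars => fun x => x
  | ComplexScalars => fun z => complex.Re z
  end.
Arguments scalar_re {R k}.

Notation banach R k := (completeNormedModType (scalar_field R k)).

(* The norm of a normed module over [K] takes its values in [K], as nonnegative
   elements; taking real parts identifies these with nonnegative reals. *)
Definition rnorm (R : realType) (k : scalars) (E : banach R k) (x : E) : R :=
  scalar_re `|x|.

(* Sequences are indexed from 0, so [rademacher t j] is r_{j+1}(t), that is,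
   sign (sin (2^(j+1) pi t)). *)
Definition rademacher (R : realType) (t : R) (j : nat) : int :=
  sgz (sin (2 ^+ j.+1 * pi * t)).

Definition rad_series (R : realType) (k : scalars) (E : banach R k)
    (x : nat -> E) (t : R) : nat -> E :=
  series (fun j => (rademacher t j)%:~R *: x j).

(* A rule E |-> X(E), where X(E) is given by its set of sequences and its norm.
   The norm is a total extended-real function, relevant only on X(E).
   Multilinear stability refers to nothing else of a sequence class, so the
   remaining axioms (completeness, bounds by the sup norm, ...) are left out. *)
Record seq_rule (R : realType) (k : scalars) := SeqRule {
  seq_mem : forall E : banach R k, set (nat -> E);
  seq_norm : forall E : banach R k, (nat -> E) -> \bar R
}.

Section Rad.
Context {R : realType} {k : scalars}.
Local Notation mu := (@lebesgue_measure R).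

Definition Rad_mem (E : banach R k) : set (nat -> E) :=
  [set x | {ae mu, forall t : R, t \in `[0, 1] -> cvgn (rad_series x t)}].

Definition Rad_norm (E : banach R k) (x : nat -> E) : \bar R :=
  sqrte (\int[mu]_(t in `[0%R, 1%R])
           ((rnorm (limn (rad_series x t))) ^+ 2)%:E).

Definition truncate (E : banach R k) (x : nat -> E) (N : nat) : nat -> E :=
  fun j => if (j < N)%N then x j else 0.

Definition RAD_norm (E : banach R k) (x : nat -> E) : \bar R :=
  ereal_sup [set Rad_norm (truncate x N) | N in [set: nat]].

Definition RAD_mem (E : banach R k) : set (nat -> E) :=
  [set x | (RAD_norm x < +oo)%E].

End Rad.

Definition Rad (R : realType) (k : scalars) : seq_rule R k :=
  SeqRule (@Rad_mem R k) (@Rad_norm R k).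

Definition RAD (R : realType) (k : scalars) : seq_rule R k :=
  SeqRule (@RAD_mem R k) (@RAD_norm R k).

Section Multilinear.
Context {R : realType} {k : scalars}.
Local Notation K := (scalar_field R k).
Variables (n : nat) (E : 'I_n -> banach R k) (F : banach R k).

Definition multilinear (A : (forall i, E i) -> F) : Prop :=
  forall (x : forall i, E i) (i : 'I_n) (a : K) (u v : E i),
    A (dfwith x i (a *: u + v)) = a *: A (dfwith x i u) + A (dfwith x i v).

Definition continuous_multilinear (A : (forall i, E i) -> F) : Prop :=
  multilinear A /\ continuous (A : prod_topology E -> F).

Definition op_norm (A : (forall i, E i) -> F) : \bar R :=
  ereal_sup [set (rnorm (A x))%:E
            | x in [set x : forall i, E i | forall i, rnorm (x i) <= 1]].

Definition induced (A : (forall i, E i) -> F) (x : forall i, nat -> E i) :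
    nat -> F :=
  fun j => A (fun i => x i j).

Definition induced_norm (X : seq_rule R k) (A : (forall i, E i) -> F) :
    \bar R :=
  ereal_sup [set seq_norm X (induced A x)
            | x in [set x : forall i, nat -> E i | forall i,
                seq_mem X (x i) /\ (seq_norm X (x i) <= 1)%E]].

End Multilinear.

(* The case n = 0 is excluded: a constant nonzero sequence is in no Rad(F). *)
Definition multilinearly_stable (R : realType) (k : scalars)
    (X : seq_rule R k) : Prop :=
  forall (n : nat) (E : 'I_n -> banach R k) (F : banach R k)
    (A : (forall i, E i) -> F),
    (0 < n)%N -> continuous_multilinear A ->
    (forall x : forall i, nat -> E i,
        (forall i, seq_mem X (x i)) -> seq_mem X (induced A x)) /\
    induced_norm X A = op_norm A.

(* Main.v *)
From HB Require Import structures.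
From mathcomp Require Import all_boot all_order all_algebra.
From mathcomp Require Import complex.
From mathcomp Require Import all_classical all_reals all_analysis.
From mathcomp Require Import measurable_realfun ring lra zify.
Require Import Defs.

(** Fix signs e_1, ..., e_N. If d_1, ..., d_N are independent uniform signs, then
    E (d_j d_l) = 0 for j <> l, so bilinearity gives
      sum_j e_j A(x_j, y_j) = E_d A(sum_j e_j d_j x_j, sum_l d_l y_l),
    and Cauchy-Schwarz together with the invariance of the law of d under d |-> e d
    bounds the norm of the left-hand side by ||A|| ||x||_Rad ||y||_Rad, for all
    signs e.  For more factors this is iterated, one new family of signs per
    factor, the bound at each stage being a multiplicative convolution on the cube
    of the functions e |-> ||sum_j e_j x^i_j|| ([averaging]).  An L2 bound on
    sum_j e_j A(x^1_j, ..., x^n_j) follows ([energy_induced]), which even holds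
    pointwise in e as soon as n >= 2 ([rnorm_int_comb_induced]).

    Everything finite takes place on the sign cube: the Rademacher functions
    r_1, ..., r_N have as joint law on [0,1] the uniform measure on the cube
    ([integral_rad_word]), so [energy N x], the mean over the cube of
    ||sum_(j < N) e_j x_j||^2, is the squared Rad-norm of the truncated sequence,
    and the RAD-norm is the supremum of the square roots of these energies.

    The sequences in Rad(E) are given by almost sure convergence only, and two
    facts are needed about them.  First, the energies of their tails tend to 0
    ([energy_tail_small]): almost sure convergence gives convergence in
    probability, and for Rademacher sums a bound in probability is as good as a
    bound in L2.  The latter combines the Paley-Zygmund argument with the inequality
    E ||S||^2 <= 2 (E ||S||)^2, proved after Latala and Oleszkiewicz
    ([energy_le_cube_avg], [energy_le_small]).  Second, the Rad-norm and the
    RAD-norm agree on Rad(E) ([RAD_norm_Rad]), by Fatou's lemma and the vanishing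
    of the tails.

    With these, membership of (A(x_j))_j in Rad(F) for n >= 2 follows from the
    pointwise bound applied to tails, the factors of which tend to 0; for n = 1 the
    partial sums are the images under A of convergent partial sums.  The upper
    bound for the induced operator is the energy estimate, and sequences supported
    at a single index give the lower bound. *)

Set Implicit Arguments.
Unset Strict Implicit.
Unset Printing Implicit Defensive.

Import Order.TTheory GRing.Theory Num.Theory.
Import numFieldNormedType.Exports.

Local Open Scope classical_set_scope.
Local Open Scope ring_scope.

(** * Sums over the sign cube *)

Section SignedSums.
Variable V : zmodType.
Implicit Types (c d e : seq int) (x : nat -> V).

(** Coefficients are integers, so that the same expression serves for sign vectors
    and for the values of the Rademacher functions, which vanish at dyadic points. *)
Definition int_comb c x : V := \sum_(j < size c) x j *~ nth 0 c j.

Lemma int_comb_nil x : int_comb [::] x = 0.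
Proof. by rewrite /int_comb big_ord0. Qed.

Lemma int_comb_cons z c x : int_comb (z :: c) x = x 0%N *~ z + int_comb c (x \o S).
Proof. by rewrite /int_comb big_ord_recl. Qed.

Lemma int_comb_rcons c z x : int_comb (rcons c z) x = int_comb c x + x (size c) *~ z.
Proof.
rewrite /int_comb size_rcons big_ord_recr /= nth_rcons ltnn eqxx; congr (_ + _).
by apply: eq_bigr => i _; rewrite nth_rcons ltn_ord.
Qed.

Lemma int_comb0 c : int_comb c (fun=> 0) = 0.
Proof. by rewrite /int_comb big1// => i _; rewrite mul0rz. Qed.

Lemma int_combD c x y : int_comb c (fun j => x j + y j) = int_comb c x + int_comb c y.
Proof. by rewrite /int_comb -big_split /=; apply: eq_bigr => i _; rewrite mulrzDl. Qed.

Lemma int_combMz c x z : int_comb c (fun j => x j *~ z) = int_comb c x *~ z.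
Proof.
by rewrite /int_comb mulrz_suml; apply: eq_bigr => i _; rewrite -!mulrzA mulrC.
Qed.

Lemma eq_int_comb c x y : (forall j, (j < size c)%N -> x j = y j) ->
  int_comb c x = int_comb c y.
Proof. by move=> xy; apply: eq_bigr => i _; rewrite xy. Qed.

End SignedSums.

Lemma raddf_int_comb (V W : zmodType) (f : {additive V -> W}) c (x : nat -> V) :
  f (int_comb c x) = int_comb c (f \o x).
Proof. by rewrite raddf_sum; apply: eq_bigr => i _; rewrite raddfMz. Qed.

Section Cube.

(** Sign vectors are lists rather than functions on an index set: sums over the cube
    then split along the first coordinate by computation, and the inequalities below
    are proved by induction on the dimension. *)
Definition cube N : pred (seq int) :=
  [pred e | (size e == N) && all (fun z => (z == 1) || (z == -1)) e].

Lemma cube_size N e : cube N e -> size e = N.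
Proof. by case/andP => /eqP. Qed.

Lemma cube_cons N z e :
  cube N.+1 (z :: e) = ((z == 1) || (z == -1)) && cube N e.
Proof. by rewrite /cube /= eqSS andbCA. Qed.

Lemma cube_rcons N z e :
  cube N.+1 (rcons e z) = ((z == 1) || (z == -1)) && cube N e.
Proof. by rewrite /cube /= size_rcons all_rcons eqSS andbCA. Qed.

Definition word_mul (e d : seq int) := [seq p.1 * p.2 | p <- zip e d].

Fixpoint cube_sum (V : zmodType) N (f : seq int -> V) : V :=
  if N is M.+1 then cube_sum M (fun e => f (1 :: e)) + cube_sum M (fun e => f (-1 :: e))
  else f [::].

Section CubeSum.
Variable V : zmodType.
Implicit Types f g : seq int -> V.

Lemma eq_cube_sum N f g : (forall e, cube N e -> f e = g e) -> cube_sum N f = cube_sum N g.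
Proof.
elim: N f g => [|N IH] f g fg /=; first exact: fg.
by congr (_ + _); apply: IH => e Ne; apply: fg; rewrite cube_cons ?eqxx ?orbT.
Qed.

Lemma cube_sumD N f g : cube_sum N (fun e => f e + g e) = cube_sum N f + cube_sum N g.
Proof. by elim: N f g => [|N IH] f g //=; rewrite !IH addrACA. Qed.

Lemma cube_sum_cst N (v : V) : cube_sum N (fun=> v) = v *+ 2 ^ N.
Proof. by elim: N => [|N IH] //=; rewrite IH -mulr2n -mulrnA expnSr. Qed.

(** The cube is a group, and its uniform measure is translation invariant. *)
Lemma cube_sum_word_mul N e f : cube N e -> cube_sum N (fun d => f (word_mul e d)) = cube_sum N f.
Proof.
elim: N e f => [|N IH] [|z e] f //; rewrite cube_cons => /andP[z1 Ne].
have E w : cube_sum N (fun d => f (word_mul (z :: e) (w :: d))) =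
    cube_sum N (fun d => f (z * w :: d)).
  exact: (IH e (fun d => f (z * w :: d))).
rewrite /= !E; case/orP: z1 => /eqP->; first by rewrite !mul1r.
by rewrite mulr1 mulrNN mulr1 addrC.
Qed.

Lemma cube_sum_rcons N f :
  cube_sum N.+1 f = cube_sum N (fun e => f (rcons e 1) + f (rcons e (-1))).
Proof.
elim: N f => [|N IH] f //.
have -> : cube_sum N.+2 f =
    cube_sum N.+1 (fun e => f (1 :: e)) + cube_sum N.+1 (fun e => f (-1 :: e)) by [].
by rewrite (IH (fun e => f (1 :: e))) (IH (fun e => f (-1 :: e))).
Qed.

End CubeSum.

(** The orthogonality relations of independent signs, E (d_j d_l) = 0 for j <> l:
    averaging over [d] a double sum with coefficients e_j d_j d_l keeps its diagonal. *)
Lemma cube_sum_orth (V : zmodType) (B : nat -> nat -> V) N e : cube N e ->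
  cube_sum N (fun d => int_comb (word_mul e d) (fun j => int_comb d (B j))) =
  int_comb e (fun j => B j j) *+ 2 ^ N.
Proof.
elim: N B e => [|N IH] B [|z e] // => [_|]; first by rewrite /= !int_comb_nil mul0rn.
rewrite cube_cons => /andP[zs Ne] /=.
have E w : (w == 1) || (w == -1) ->
  cube_sum N (fun d => int_comb (word_mul (z :: e) (w :: d)) (fun j => int_comb (w :: d) (B j))) =
  cube_sum N (fun d => B 0%N 0%N *~ z +
    int_comb (word_mul e d) (fun j => int_comb d (B j.+1 \o S)) +
    (int_comb d (B 0%N \o S) *~ z + int_comb (word_mul e d) (fun j => B j.+1 0%N)) *~ w).
  move=> w1; apply: eq_cube_sum => d _; rewrite [word_mul _ _]/= !int_comb_cons.
  have -> : int_comb (word_mul e d) ((fun j => int_comb (w :: d) (B j)) \o S) =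
      int_comb (word_mul e d) (fun j => B j.+1 0%N) *~ w +
      int_comb (word_mul e d) (fun j => int_comb d (B j.+1 \o S)).
    rewrite -int_combMz -int_combD; apply: eq_int_comb => j _ /=; exact: int_comb_cons.
  (* The diagonal term carries w^2 = 1, the mixed terms a factor w. *)
  have wzw : w * (z * w) = z by case/orP: w1 => /eqP->; lia.
  rewrite !mulrzDl -!mulrzA wzw [X in _ + X = _]addrC.
  exact: addrACA.
rewrite /= !E//= -cube_sumD int_comb_cons mulrnDl expnSr [X in _ = _ + X]mulrnA.
rewrite -(IH (fun i j => B i.+1 j.+1))// mulrnA -cube_sum_cst -!mulrnDl/= -cube_sumD.
rewrite mulr2n -cube_sumD; apply: eq_cube_sum => d _.
(* The contributions of w = 1 and w = -1 to the mixed terms cancel. *)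
by rewrite mulrN1z mulr1z addrACA subrr addr0.
Qed.

End Cube.

(** * Real-valued norms *)

Section RealNorm.
Context {R : realType} {k : scalars}.
Local Notation K := (scalar_field R k).

(** The inverse, on nonnegative scalars, of the real part used in [rnorm]. *)
Definition emb : R -> K :=
  match k with
  | RealScalars => fun r => r
  | ComplexScalars => fun r => (r +i* 0)%C
  end.

Lemma embK : cancel emb scalar_re.
Proof. by rewrite /emb; case: k. Qed.

Lemma scalar_reK (z : K) : 0 <= z -> emb (scalar_re z) = z.
Proof.
rewrite /emb; case: k z => // -[a b] /=.
by rewrite lecE /= => /andP[/eqP<- _].
Qed.

Lemma scalar_reD (z w : K) : scalar_re (z + w) = scalar_re z + scalar_re w.
Proof. by case: k z w => // -[a b] [c d]. Qed.

Lemma embM r s : emb (r * s) = emb r * emb s.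
Proof.
rewrite /emb; case: k => //.
by apply/eqP; rewrite eq_complex /= !mulr0 !mul0r subr0 addr0 !eqxx.
Qed.

Lemma ler_emb r s : (emb r <= emb s) = (r <= s).
Proof. by rewrite /emb; case: k => //; rewrite lecE /= eqxx. Qed.

Lemma ltr_emb r s : (emb r < emb s) = (r < s).
Proof. by rewrite /emb; case: k => //; rewrite ltcE /= eqxx. Qed.

Lemma emb0 : emb 0 = 0.
Proof. by rewrite /emb; case: k. Qed.

Lemma emb1 : emb 1 = 1.
Proof. by rewrite /emb; case: k. Qed.

Lemma emb_prod (I : Type) (s : seq I) (P : pred I) (f : I -> R) :
  emb (\prod_(i <- s | P i) f i) = \prod_(i <- s | P i) emb (f i).
Proof. exact: (big_morph _ embM emb1). Qed.

Variable E : banach R k.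
Implicit Types u v : E.

Lemma normE u : `|u| = emb (rnorm u).
Proof. by rewrite scalar_reK. Qed.

Lemma rnorm_ge0 u : 0 <= rnorm u.
Proof. by rewrite -ler_emb -normE emb0. Qed.

Lemma rnorm0 : rnorm (0 : E) = 0.
Proof. by rewrite /rnorm normr0 -emb0 embK. Qed.

Lemma rnorm_eq0 u : rnorm u = 0 -> u = 0.
Proof. by move=> u0; apply/eqP; rewrite -normr_eq0 normE u0 emb0. Qed.

Lemma rnormD u v : rnorm (u + v) <= rnorm u + rnorm v.
Proof.
rewrite /rnorm -scalar_reD -ler_emb !scalar_reK ?addr_ge0//.
exact: ler_normD.
Qed.

Lemma rnormN u : rnorm (- u) = rnorm u.
Proof. by rewrite /rnorm normrN. Qed.

Lemma rnormB u v : rnorm (u - v) = rnorm (v - u).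
Proof. by rewrite -rnormN opprB. Qed.

Lemma rnormZ_emb r u : 0 <= r -> rnorm (emb r *: u) = r * rnorm u.
Proof.
move=> r0; rewrite -[RHS]embK embM -normE /rnorm normrZ ger0_norm//.
by rewrite -emb0 ler_emb.
Qed.

Lemma rnormMn u n : rnorm (u *+ n) = rnorm u *+ n.
Proof.
rewrite /rnorm normrMn; elim: n => [|n IH]; last by rewrite !mulrSr scalar_reD IH.
by rewrite !mulr0n -emb0 embK.
Qed.

Lemma rnorm_sign u (z : int) : (z == 1) || (z == -1) -> rnorm (u *~ z) = rnorm u.
Proof. by case/orP => /eqP->; rewrite ?mulrN1z ?rnormN. Qed.

Lemma rnorm_cube_sum N f : rnorm (cube_sum N f : E) <= cube_sum N (fun e => rnorm (f e)).
Proof.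
elim: N f => [|N IH] f //=.
by apply: (le_trans (rnormD _ _)); apply: lerD.
Qed.

Lemma cvg_rnorm (u : nat -> E) l : u @ \oo --> l ->
  (fun n => rnorm (u n)) @ \oo --> rnorm l.
Proof.
move=> ul; apply/cvgrPdist_le => /= e e0.
have e0' : 0 < emb e by rewrite -emb0 ltr_emb.
move/cvgrPdist_le : ul => /(_ _ e0'); apply: filterS => n.
rewrite normE ler_emb; apply: le_trans.
rewrite ler_norml; apply/andP; split.
  by have := rnormD l (u n - l); rewrite addrC subrK rnormB; lra.
by have := rnormD (u n) (l - u n); rewrite addrC subrK; lra.
Qed.

Lemma rnorm_cvg (u : nat -> E) l :
  (forall e : R, 0 < e -> exists m, forall p, (m <= p)%N -> rnorm (l - u p) <= e) ->
  u @ \oo --> l.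
Proof.
move=> H; apply/cvgrPdist_le => e e0.
have e0' : 0 < scalar_re e by rewrite -ltr_emb emb0 scalar_reK// ltW.
have [m Hm] := H _ e0'; exists m => // p /= mp.
by rewrite normE -(scalar_reK (ltW e0)) ler_emb Hm.
Qed.

Lemma rnorm_cauchy_cvg (u : nat -> E) :
  (forall e : R, 0 < e -> exists m, forall p q,
     (m <= p)%N -> (p <= q)%N -> rnorm (u q - u p) <= e) -> cvgn u.
Proof.
move=> H; apply/cauchy_cvgP/cauchy_exP => e e0.
have e0' : 0 < scalar_re e by rewrite -ltr_emb emb0 scalar_reK// ltW.
have e20 : 0 < scalar_re e / 2 by rewrite divr_gt0.
have [m Hm] := H _ e20; exists (u m).
exists m => // q /= mq; rewrite -ball_normE /= distrC normE -(scalar_reK (ltW e0)).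
rewrite ltr_emb (le_lt_trans (Hm m q _ _))// ltr_pdivrMr// ltr_pMr//.
by rewrite ltr1n.
Qed.

Lemma cvg_rnorm_cauchy (u : nat -> E) : cvgn u ->
  forall e : R, 0 < e -> exists m, forall p q,
     (m <= p)%N -> (m <= q)%N -> rnorm (u q - u p) <= e.
Proof.
move=> cu e e0.
have e0' : 0 < emb (e / 2) by rewrite -emb0 ltr_emb divr_gt0.
have /cauchyP/(_ _ e0')[v] : cauchy (u @ \oo) by exact: cvg_cauchy.
case=> m _ Hm; exists m => p q mp mq.
have H i : (m <= i)%N -> rnorm (v - u i) <= e / 2.
  by move=> /(Hm i); rewrite /= -ball_normE /= normE ltr_emb => /ltW.
have := rnormD (u q - v) (v - u p); rewrite addrA subrK rnormB.
by have := H _ mp; have := H _ mq; lra.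
Qed.

End RealNorm.

(** * Averages over the sign cube and Kahane-Khintchine *)

Section Average.
Variable R : realFieldType.
Implicit Types f g : seq int -> R.

Definition cube_avg N f : R := cube_sum N f / 2 ^+ N.

Lemma cube_avg0 f : cube_avg 0 f = f [::].
Proof. by rewrite /cube_avg /= expr0 divr1. Qed.

Lemma cube_avgS N f :
  cube_avg N.+1 f = (cube_avg N (fun e => f (1 :: e)) + cube_avg N (fun e => f (-1 :: e))) / 2.
Proof. by rewrite /cube_avg /= exprSr invfM mulrA -mulrDl. Qed.

Lemma eq_cube_avg N f g : (forall e, cube N e -> f e = g e) -> cube_avg N f = cube_avg N g.
Proof. by move=> fg; rewrite /cube_avg (eq_cube_sum fg). Qed.

Lemma cube_avgD N f g : cube_avg N (fun e => f e + g e) = cube_avg N f + cube_avg N g.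
Proof. by rewrite /cube_avg cube_sumD mulrDl. Qed.

Lemma cube_avgZ N a f : cube_avg N (fun e => a * f e) = a * cube_avg N f.
Proof.
by rewrite /cube_avg mulrA; congr (_ / _); elim: N f => [|N IH] f //=; rewrite mulrDr !IH.
Qed.

Lemma cube_avgN N f : cube_avg N (fun e => - f e) = - cube_avg N f.
Proof.
by rewrite -mulN1r -cube_avgZ; apply: eq_cube_avg => e _; rewrite mulN1r.
Qed.

Lemma cube_avg_cst N a : cube_avg N (fun=> a) = a.
Proof. by rewrite /cube_avg cube_sum_cst -[a *+ _]mulr_natr natrX mulfK ?expf_neq0. Qed.

Lemma ler_cube_avg N f g : (forall e, cube N e -> f e <= g e) -> cube_avg N f <= cube_avg N g.
Proof.
elim: N f g => [|N IH] f g fg; first by rewrite !cube_avg0 fg.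
rewrite !cube_avgS ler_pM2r ?invr_gt0//; apply: lerD; apply: IH => e Ne;
  by apply: fg; rewrite cube_cons Ne.
Qed.

Lemma cube_avg_ge0 N f : (forall e, cube N e -> 0 <= f e) -> 0 <= cube_avg N f.
Proof. by move=> f0; rewrite -(cube_avg_cst N 0); apply: ler_cube_avg. Qed.

Lemma cube_avg_word_mul N e f : cube N e -> cube_avg N (fun d => f (word_mul e d)) = cube_avg N f.
Proof. by move=> Ne; rewrite /cube_avg cube_sum_word_mul. Qed.

Lemma cube_avg_rcons N f :
  cube_avg N.+1 f = cube_avg N (fun e => (f (rcons e 1) + f (rcons e (-1))) / 2).
Proof.
rewrite [RHS](@eq_cube_avg _ _ (fun e => 2^-1 * (f (rcons e 1) + f (rcons e (-1))))).
  rewrite cube_avgZ /cube_avg cube_sum_rcons exprSr invfM; ring.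
by move=> e _; rewrite mulrC.
Qed.

(** Induction on the dimension: the step is Cauchy-Schwarz for two terms,
    p q + p' q' <= sqrt (p^2 + p'^2) sqrt (q^2 + q'^2), in polynomial form. *)
Lemma cube_avg_CauchySchwarz N f g :
  cube_avg N (fun e => f e * g e) ^+ 2 <=
  cube_avg N (fun e => f e ^+ 2) * cube_avg N (fun e => g e ^+ 2).
Proof.
elim: N f g => [|N IH] f g; first by rewrite !cube_avg0 exprMn.
rewrite !cube_avgS.
have := IH (fun e => f (1 :: e)) (fun e => g (1 :: e)).
have := IH (fun e => f (-1 :: e)) (fun e => g (-1 :: e)).
have P z h : 0 <= cube_avg N (fun e => h (z :: e) ^+ 2).
  by apply: cube_avg_ge0 => e _; exact: sqr_ge0.
move: (P 1 f) (P 1 g) (P (-1) f) (P (-1) g).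
move: (cube_avg N (fun e => f (1 :: e) ^+ 2)) => a.
move: (cube_avg N (fun e => g (1 :: e) ^+ 2)) => b.
move: (cube_avg N (fun e => f (-1 :: e) ^+ 2)) => c.
move: (cube_avg N (fun e => g (-1 :: e) ^+ 2)) => d.
move: (cube_avg N _) => p; move: (cube_avg N _) => q a0 b0 c0 d0 q2 p2.
have ad0 := mulr_ge0 a0 d0; have bc0 := mulr_ge0 b0 c0.
have pq : 2 * (p * q) <= a * d + b * c.
  have [pq|/ltW pq] := lerP (p * q) 0; first by lra.
  rewrite -ler_sqr ?nnegrE; [|by lra..].
  have : p ^+ 2 * q ^+ 2 <= (c * d) * (a * b) by apply: ler_pM => //; exact: sqr_ge0.
  have := sqr_ge0 (a * d - b * c).
  by rewrite -exprMn; move: (p * q) => pq'; nra.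
by lra.
Qed.

Lemma cube_avg_Jensen N f : cube_avg N f ^+ 2 <= cube_avg N (fun e => f e ^+ 2).
Proof.
have := cube_avg_CauchySchwarz N f (fun=> 1); rewrite expr1n cube_avg_cst mulr1.
by congr (_ ^+ 2 <= _); apply: eq_cube_avg => e _; rewrite mulr1.
Qed.

(** A convolution of two functions on the cube is bounded uniformly by the product
    of their L2 norms. *)
Lemma le_convolution N f g e : cube N e ->
  cube_avg N (fun d => f (word_mul e d) * g d) ^+ 2 <=
  cube_avg N (fun d => f d ^+ 2) * cube_avg N (fun d => g d ^+ 2).
Proof.
move=> Ne; rewrite -(cube_avg_word_mul (fun d => f d ^+ 2) Ne).
exact: cube_avg_CauchySchwarz.
Qed.

End Average.

Section Poincare.
Variable R : realFieldType.
Implicit Types f g : seq int -> R.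

(** The neighbours of a vertex in the hypercube graph. *)
Fixpoint flips (e : seq int) : seq (seq int) :=
  if e is z :: d then (- z :: d) :: [seq z :: d' | d' <- flips d] else [::].

(** The quadratic form of the adjacency operator of the hypercube. Its eigenvalues are
    N - 2 j, on the Walsh functions of degree j, so bounding it from above on
    functions orthogonal to low degrees is a spectral gap estimate. *)
Definition flip_form N f g : R := cube_avg N (fun e => f e * \sum_(d <- flips e) g d).

Definition half_sum f : seq int -> R := fun e => (f (1 :: e) + f (-1 :: e)) / 2.
Definition half_diff f : seq int -> R := fun e => (f (1 :: e) - f (-1 :: e)) / 2.

Lemma cube_avgS_half N f : cube_avg N.+1 f = cube_avg N (half_sum f).
Proof.
rewrite cube_avgS -cube_avgD mulrC -cube_avgZ; apply: eq_cube_avg => e _.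
by rewrite mulrC.
Qed.

Lemma cube_avgS_sqr N f : cube_avg N.+1 (fun e => f e ^+ 2) =
  cube_avg N (fun e => half_sum f e ^+ 2) + cube_avg N (fun e => half_diff f e ^+ 2).
Proof.
rewrite cube_avgS -!cube_avgD mulrC -cube_avgZ; apply: eq_cube_avg => e _.
by rewrite /half_sum /half_diff; field.
Qed.

(** The even and odd parts in the first coordinate are orthogonal, both for the L2
    product and for the form, and flipping that coordinate acts on them as 1 and -1. *)
Lemma flip_formS N f : flip_form N.+1 f f =
  flip_form N (half_sum f) (half_sum f) + flip_form N (half_diff f) (half_diff f) +
  cube_avg N (fun e => half_sum f e ^+ 2) - cube_avg N (fun e => half_diff f e ^+ 2).
Proof.
rewrite /flip_form cube_avgS -cube_avgN -!cube_avgD mulrC -cube_avgZ; apply: eq_cube_avg => e _ /=.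
rewrite !big_cons !big_map opprK /half_sum /half_diff -!mulr_suml sumrB big_split /=.
by field.
Qed.

Definition even_fun f := forall e, f [seq - z | z <- e] = f e.
Definition odd_fun f := forall e, f [seq - z | z <- e] = - f e.

Lemma cube_avg_opp N f : cube_avg N (fun e => f [seq - z | z <- e]) = cube_avg N f.
Proof.
elim: N f => [|N IH] f; first by rewrite !cube_avg0.
by rewrite !cube_avgS /= opprK (IH (fun e => f (-1 :: e))) (IH (fun e => f (1 :: e))) addrC.
Qed.

Lemma cube_avg_odd N f : odd_fun f -> cube_avg N f = 0.
Proof.
move=> of_; have := cube_avg_opp N f.
by rewrite (eq_cube_avg (fun e _ => of_ e)) cube_avgN; lra.
Qed.

(** Poincare's inequality: away from the constants, the adjacency operator is at most
    N - 2. *)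
Lemma flip_form_le N f :
  flip_form N f f <= (N%:R - 2) * cube_avg N (fun e => f e ^+ 2) + 2 * cube_avg N f ^+ 2.
Proof.
elim: N f => [|N IH] f; first by rewrite /flip_form !cube_avg0 big_nil; nra.
rewrite flip_formS cube_avgS_sqr cube_avgS_half -natr1.
have := IH (half_sum f); have := IH (half_diff f).
by have := cube_avg_Jensen N (half_diff f); lra.
Qed.

(** An even function has no component of degree 1, so off the constants the spectrum
    starts at N - 4. In the induction the part that is odd in the first coordinate is an
    odd function of the others; it has mean zero, and [flip_form_le] is sharp enough
    for it. *)
Lemma flip_form_le_even N f : even_fun f ->
  flip_form N f f <= (N%:R - 4) * cube_avg N (fun e => f e ^+ 2) + 4 * cube_avg N f ^+ 2.
Proof.
elim: N f => [|N IH] f ef; first by rewrite /flip_form !cube_avg0 big_nil; nra.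
rewrite flip_formS cube_avgS_sqr cube_avgS_half -natr1.
have es : even_fun (half_sum f).
  by move=> e; rewrite /half_sum -(ef (1 :: e)) -(ef (-1 :: e))/= opprK addrC.
have od : odd_fun (half_diff f).
  move=> e; rewrite /half_diff -(ef (1 :: e)) -(ef (-1 :: e))/= opprK.
  by rewrite -mulNr opprB.
have := IH _ es; have := flip_form_le N (half_diff f); rewrite (cube_avg_odd _ od).
by lra.
Qed.

End Poincare.

Section KahaneKhintchine.
Context {R : realType} {k : scalars} (E : banach R k).
Implicit Types x : nat -> E.

Lemma size_flips e : size (flips e) = size e.
Proof. by elim: e => //= z e IH; rewrite size_map IH. Qed.

(** Each term of a signed sum changes sign in exactly one neighbour, so the values at
    the N neighbours add up to N - 2 times the value. *)
Lemma sum_flips e x :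
  \sum_(d <- flips e) int_comb d x + int_comb e x *+ 2 = int_comb e x *+ size e.
Proof.
elim: e x => [|z e IH] x; first by rewrite big_nil int_comb_nil !mul0rn addr0.
rewrite big_cons big_map /= !int_comb_cons.
under eq_bigr do rewrite int_comb_cons.
rewrite big_split /= big_const_seq count_predT iter_addr_0 size_flips mulrNz.
move: (x 0%N *~ z) (int_comb e _) (\sum_(d <- _) _) (IH (x \o S)) => a I F IF.
rewrite !mulrnDl [I *+ (size e).+1]mulrS -IF [a *+ (size e).+1]mulrS.
rewrite [in LHS]addrACA [a *+ 2]mulr2n !addrA.
by rewrite [- a + I]addrC subrK [I + a]addrC (addrAC a I).
Qed.

Definition energy N x : R := cube_avg N (fun e => rnorm (int_comb e x) ^+ 2).

Lemma int_comb_opp e x : int_comb [seq - z | z <- e] x = - int_comb e x.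
Proof.
elim: e x => [|z e IH] x /=; first by rewrite !int_comb_nil oppr0.
by rewrite !int_comb_cons IH mulrNz opprD.
Qed.

(** Kahane's inequality with the constant of Latala and Oleszkiewicz. With h the norm of
    the signed sum, [sum_flips] and the triangle inequality show that the sum of h over
    the neighbours is at least (N - 2) h, so the form is at least (N - 2) E h^2; as h is
    even, it is at most (N - 4) E h^2 + 4 (E h)^2. *)
Lemma energy_le_cube_avg N x : energy N x <= 2 * cube_avg N (fun e => rnorm (int_comb e x)) ^+ 2.
Proof.
set h := fun e => rnorm (int_comb e x).
have eh : even_fun h by move=> e; rewrite /h int_comb_opp rnormN.
have := flip_form_le_even N eh; rewrite -/(energy N x).
suff : N%:R * energy N x <= flip_form N h h + 2 * energy N x by lra.
rewrite /energy /flip_form -!cube_avgZ -cube_avgD; apply: ler_cube_avg => e Ne; rewrite -/(h e).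
suff : N%:R * h e <= \sum_(d <- flips e) h d + 2 * h e.
  by have := rnorm_ge0 (int_comb e x); rewrite -/(h e); nra.
rewrite !mulr_natl -!rnormMn -(cube_size Ne) -sum_flips.
apply: (le_trans (rnormD _ _)); rewrite lerD2r.
elim: (flips e) => [|d s IH]; first by rewrite !big_nil rnorm0.
by rewrite !big_cons (le_trans (rnormD _ _))// lerD2l.
Qed.

(** The Paley-Zygmund argument. If ||S|| > c has probability at most 1/8, then by
    Cauchy-Schwarz and [energy_le_cube_avg] this event contributes at most half of the
    mean, so E ||S|| <= 2 c. *)
Lemma energy_le_small N x (c : R) : 0 <= c ->
  cube_avg N (fun e => ((c < rnorm (int_comb e x))%R%:R : R)) <= 1 / 8 ->
  energy N x <= 8 * c ^+ 2.
Proof.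
move=> c0; set p := cube_avg N _ => p8.
have := energy_le_cube_avg N x; set m := cube_avg N _ => Em.
have m0 : 0 <= m by apply: cube_avg_ge0 => e _; exact: rnorm_ge0.
suff mc : m <= 2 * c by nra.
have : m <= c + cube_avg N (fun e => rnorm (int_comb e x) * ((c < rnorm (int_comb e x))%R%:R : R)).
  rewrite -{1}(cube_avg_cst N c) -cube_avgD; apply: ler_cube_avg => e _.
  by case: ltP => h; rewrite ?mulr1 ?mulr0; lra.
have := cube_avg_CauchySchwarz N (fun e => rnorm (int_comb e x))
  (fun e => ((c < rnorm (int_comb e x))%R%:R : R)).
have -> : cube_avg N (fun e => ((c < rnorm (int_comb e x))%R%:R : R) ^+ 2) = p.
  by apply: eq_cube_avg => e _; case: ltP; rewrite ?expr1n ?expr0n.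
rewrite -/(energy N x); move: (cube_avg N _) => q qE mq.
have : q ^+ 2 <= (m / 2) ^+ 2.
  apply: (le_trans qE).
  have E0 : 0 <= energy N x by apply: cube_avg_ge0 => e _; exact: sqr_ge0.
  by nra.
have [q0|/ltW q0] := lerP q 0; first by lra.
by rewrite ler_sqr ?nnegrE; lra.
Qed.

(** The norm is convex: averaging over the sign of one more term increases the mean of
    its square. *)
Lemma energy_homo x m n : (m <= n)%N -> energy m x <= energy n x.
Proof.
move: m n; apply: (@homo_leq _ (energy^~ x) <=%R) => // [y z t|N]; first exact: le_trans.
rewrite /energy cube_avg_rcons; apply: ler_cube_avg => e _; rewrite !int_comb_rcons mulr1z mulrN1z.
have := rnormD (int_comb e x + x (size e)) (int_comb e x - x (size e)).
rewrite addrACA subrr addr0 -mulr2n rnormMn.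
have := rnorm_ge0 (int_comb e x).
move: (rnorm _) (rnorm _) (rnorm _) => c b a a0 abc.
have := sqr_ge0 (b - c).
suff : a ^+ 2 <= ((b + c) / 2) ^+ 2 by nra.
by rewrite ler_sqr ?nnegrE; lra.
Qed.

Lemma energy_ge0 N x : 0 <= energy N x.
Proof. by apply: cube_avg_ge0 => e _; exact: sqr_ge0. Qed.

End KahaneKhintchine.

(** * The law of the Rademacher functions *)

Section RademacherLaw.
Variable R : realType.
Local Notation mu := (@lebesgue_measure R).
Implicit Types (t : R) (e d : seq int).

Definition rad_word t N : seq int := mkseq (rademacher t) N.

Lemma rad_wordS t N : rad_word t N.+1 = rcons (rad_word t N) (rademacher t N).
Proof. by rewrite /rad_word mkseqS. Qed.

Lemma measurable_rademacher j (z : int) :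
  measurable [set t : R | rademacher t j = z].
Proof.
have mf : measurable_fun setT (fun t : R => sin (2 ^+ j.+1 * pi * t)).
  apply: measurableT_comp => //.
  by apply: continuous_measurable_fun; exact: continuous_sin.
have mz : measurable [set y : R | sgz y = z].
  have [->|z1] := eqVneq z 1.
    rewrite (_ : [set _ | _] = `]0%R, +oo[%classic); first exact: measurable_itv.
    apply/seteqP; split => y /=; rewrite in_itv /= andbT; first by case: sgzP.
    by move=> /gtr0_sgz.
  have [->|z2] := eqVneq z (-1).
    rewrite (_ : [set _ | _] = `]-oo, 0%R[%classic); first exact: measurable_itv.
    apply/seteqP; split => y /=; rewrite in_itv /=; first by case: sgzP.
    by move=> /ltr0_sgz.
  have [->|z3] := eqVneq z 0.
    rewrite (_ : [set _ | _] = [set 0]); first exact: measurable_set1.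
    apply/seteqP; split => y /=; first by move/eqP; rewrite sgz_eq0 => /eqP.
    by move=> ->; rewrite sgz0.
  rewrite (_ : [set _ | _] = set0); first exact: measurable0.
  apply/seteqP; split => y //= yz; move: z1 z2 z3; rewrite -yz.
  by case: sgzP; rewrite ?eqxx.
by have := mf measurableT _ mz; rewrite setTI.
Qed.

(** Finite integer words form a countable type, so it suffices to treat one word, and
    there one coordinate, at a time. *)
Lemma measurable_rad_word (A : set (seq int)) N :
  measurable [set t : R | A (rad_word t N)].
Proof.
rewrite (_ : [set _ | _] = \bigcup_(c in A) [set t : R | rad_word t N = c]); last first.
  apply/seteqP; split => t /=; first by exists (rad_word t N).
  by case=> c Ac /= ->.
rewrite bigcup_mkcond; apply: countable_bigcupT_measurable; first exact: countableP.
move=> c; case: ifP => // _; elim: N c {A} => [|N IH] c.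
  have [->|c0] := eqVneq c [::].
    by rewrite (_ : [set _ | _] = setT)//; apply/seteqP; split.
  rewrite (_ : [set _ | _] = set0)//; apply/seteqP; split => t //= tc.
  by move: c0; rewrite -tc.
case/lastP: c => [|c z].
  by rewrite (_ : [set _ | _] = set0)//; apply/seteqP; split.
rewrite (_ : [set _ | _] = [set t : R | rad_word t N = c] `&` [set t | rademacher t N = z]).
  by apply: measurableI; [exact: IH|exact: measurable_rademacher].
apply/seteqP; split => t /=; first by rewrite rad_wordS => /rcons_inj[-> ->].
by rewrite rad_wordS => -[-> ->].
Qed.

Lemma measurable_fun_rad_word (D : set R) (F : seq int -> R) N :
  measurable_fun D (fun t => F (rad_word t N)).
Proof.
move=> mD Y mY; apply: measurableI => //.
exact: (measurable_rad_word (F @^-1` Y)).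
Qed.

(** The left end point of the dyadic interval of length 2^-N in the interior of which the
    first N Rademacher functions take the values [e]: a sign -1 is the binary digit 1. *)
Fixpoint dyadic e : R :=
  if e is z :: d then ((z == -1)%:R + dyadic d) / 2 else 0.

Lemma dyadic_rcons e z :
  dyadic (rcons e z) = dyadic e + (z == -1)%:R / 2 ^+ (size e).+1.
Proof.
elim: e => [|w e IH] /=; first by rewrite addr0 add0r expr1.
by rewrite IH [in RHS]exprS invfM; field.
Qed.

Lemma dyadic_itv N e : cube N e -> 0 <= dyadic e /\ dyadic e + 2 ^- N <= 1.
Proof.
elim: N e => [|N IH] [|z e] // => [_|]; first by rewrite /= expr0 invr1 add0r.
rewrite cube_cons => /andP[_ /IH[]] /=; rewrite exprS invfM.
by case: eqP => _ /=; lra.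
Qed.

(** The doubling map on the circle shifts the sequence of Rademacher functions. *)
Lemma rademacher_shift t (b : bool) j :
  rademacher (2 * t - b%:R) j = rademacher t j.+1.
Proof.
rewrite /rademacher; congr sgz.
rewrite -(periodicn (@sinD2pi R) (2 ^ j * b)); congr sin.
by rewrite -mulrnA -[pi *+ _]mulr_natl !natrM natrX !exprS; ring.
Qed.

Lemma rademacher_half t (b : bool) :
  b%:R / 2 < t < (b%:R + 1) / 2 -> rademacher t 0 = (-1) ^+ b.
Proof.
rewrite /rademacher expr1 => /andP[]; have := pi_gt0 R; case: b => /= p0 t1 t2.
- apply: ltr0_sgz; rewrite -[_ * t](subrK pi) sinDpi oppr_lt0 sin_gt0_pi//.
  by apply/andP; split; nra.
- by apply: gtr0_sgz; rewrite sin_gt0_pi//; apply/andP; split; nra.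
Qed.

Lemma rad_word_dyadic N e t : cube N e ->
  dyadic e < t < dyadic e + 2 ^- N -> rad_word t N = e.
Proof.
elim: N e t => [|N IH] [|z e] t //; rewrite cube_cons => /andP[z1 Ne] te.
have [d0 d1] := dyadic_itv Ne.
have zE : (-1) ^+ (z == -1) = z by case/orP: z1 => /eqP->.
rewrite -[RHS](congr1 (cons^~ e) zE) /rad_word /mkseq /= (iotaDl 1 0 N) -map_comp.
move: te; rewrite /= exprS invfM => /andP[te1 te2].
congr (_ :: _).
  by apply: rademacher_half; apply/andP; split; lra.
rewrite -[RHS](IH e (2 * t - (z == -1)%:R))//; last by apply/andP; split; lra.
apply: eq_map => j /=; by rewrite rademacher_shift.
Qed.

Local Open Scope ereal_scope.

(** Induction on the number of remaining coordinates, halving the interval each time; when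
    none is left the integrand is constant on the open interval. *)
Lemma integral_dyadic M N e (F : seq int -> R) : (forall c, 0 <= F c)%R ->
  cube M e ->
  \int[mu]_(t in `[dyadic e, (dyadic e + 2 ^- M)%R[%classic) (F (rad_word t (M + N)))%:E =
  (2 ^- M * cube_avg N (fun d => F (e ++ d)))%:E.
Proof.
move=> F0; elim: N M e => [|N IH] M e Me.
  rewrite addn0 cube_avg0 cats0 integral_itv_bndoo; last first.
    by apply/measurable_EFinP; exact: measurable_fun_rad_word.
  rewrite (eq_integral (cst (F e)%:E)); last first.
    by move=> t; rewrite inE /= in_itv /= => /(rad_word_dyadic Me) ->.
  rewrite integral_cst//= lebesgue_measure_itv /= lte_fin ltrDl.
  by rewrite invr_gt0 exprn_gt0// -EFinB -EFinM mulrC addrAC subrr add0r.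
pose m : R := (dyadic e + 2 ^- M.+1)%R.
have M0 : (0 < 2 ^- M.+1 :> R)%R by rewrite invr_gt0 exprn_gt0.
have M1 : (2 ^- M = 2 * 2 ^- M.+1 :> R)%R.
  by rewrite exprS invfM mulrA mulfV// mul1r.
rewrite (@itv_bndbnd_setU _ _ _ (BLeft m)); last 2 first.
- by rewrite bnd_simp lerDl ltW.
- by rewrite bnd_simp lerD2l M1; lra.
rewrite ge0_integral_setU//=; last 3 first.
- by apply/measurable_EFinP; exact: measurable_fun_rad_word.
- by move=> t _; rewrite lee_fin.
- apply/disj_setPS => t /=; rewrite !in_itv/= => -[/andP[_ a] /andP[b _]].
  by move: (lt_le_trans a b); rewrite ltxx.
have I (z : int) : (z == 1)%R || (z == -1)%R ->
  \int[mu]_(t in `[dyadic (rcons e z), (dyadic (rcons e z) + 2 ^- M.+1)%R[%classic)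
     (F (rad_word t (M + N.+1)))%:E =
  (2 ^- M.+1 * cube_avg N (fun d => F (e ++ z :: d)))%:E.
  move=> z1; rewrite -addSnnS IH ?cube_rcons ?z1//.
  by congr (_ * _)%:E; apply: eq_cube_avg => d _; rewrite cat_rcons.
have := I 1%R isT; have := I (-1)%R isT.
rewrite !dyadic_rcons (cube_size Me) eqxx mul1r mul0r addr0 -/m.
have -> : (m + 2 ^- M.+1 = dyadic e + 2 ^- M)%R by rewrite /m M1; lra.
move=> -> ->; rewrite -EFinD cube_avgS; congr EFin; rewrite M1; lra.
Qed.

(** The joint law of the first N Rademacher functions is uniform on the cube. *)
Lemma integral_rad_word N (F : seq int -> R) : (forall c, 0 <= F c)%R ->
  \int[mu]_(t in `[0%R, 1%R]%classic) (F (rad_word t N))%:E = (cube_avg N F)%:E.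
Proof.
move=> F0; have /= := @integral_dyadic 0%N N [::] F F0 isT.
rewrite expr0 invr1 add0r mul1r => <-.
rewrite integral_itv_bndo_bndc//.
by apply/measurable_EFinP; exact: measurable_fun_rad_word.
Qed.

End RademacherLaw.

(** * Rademacher norms as averages over the cube *)

Section RadEnergy.
Context {R : realType} {k : scalars} {E : banach R k}.
Local Notation mu := (@lebesgue_measure R).
Local Notation I01 := (`[0%R, 1%R]%classic : set R).
Implicit Types (x : nat -> E) (t c : R).

Lemma rad_seriesE x t N : rad_series x t N = int_comb (rad_word t N) x.
Proof.
rewrite /rad_series /series /int_comb /= size_mkseq big_mkord; apply: eq_bigr => j _.
by rewrite nth_mkseq// scaler_int.
Qed.

Lemma integral_rad_series x N :
  (\int[mu]_(t in I01) (rnorm (rad_series x t N) ^+ 2)%:E = (energy N x)%:E)%E.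
Proof.
under eq_integral do rewrite rad_seriesE.
by apply: (integral_rad_word N (F := fun e => rnorm (int_comb e x) ^+ 2)) => e; exact: sqr_ge0.
Qed.

Definition tail m x : nat -> E := fun j => if (m <= j)%N then x j else 0.

Lemma rad_series_tail x t m N : (m <= N)%N ->
  rad_series (tail m x) t N = rad_series x t N - rad_series x t m.
Proof.
move=> /subnK <-; rewrite addnC; elim: (N - m)%N => [|n IH].
  rewrite addn0 subrr rad_seriesE /int_comb big1// => j _.
  have := ltn_ord j; rewrite [X in (_ < X)%N]size_mkseq => jm.
  by rewrite /tail leqNgt jm mul0rz.
rewrite addnS /rad_series ![series _ (_ + _).+1]seriesSr -!/(rad_series _ _) IH.
by rewrite /tail leq_addr addrAC.
Qed.

(** Partial sums depend on finitely many Rademacher functions only, so their norms are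
    step functions. *)
Lemma measurable_rnorm_series (D : set R) x m N :
  measurable_fun D (fun t => rnorm (rad_series x t N - rad_series x t m)).
Proof.
wlog mN : m N / (m <= N)%N.
  move=> H; have /orP[mN|Nm] := leq_total m N; first exact: H.
  by under eq_fun do rewrite rnormB; exact: H.
under eq_fun do rewrite -rad_series_tail// rad_seriesE.
exact: (measurable_fun_rad_word (fun e => rnorm (int_comb e (tail m x)))).
Qed.

Lemma Rad_norm_truncate x N :
  Rad_norm (truncate x N) = (Num.sqrt (energy N x))%:E.
Proof.
rewrite /Rad_norm -[RHS]/(sqrte (energy N x)%:E) -integral_rad_series; congr sqrte.
apply: eq_integral => t _; congr (rnorm _ ^+ 2)%:E.
apply: lim_near_cst => //; exists N => // M /= NM.
rewrite -[M](subnK NM) addnC; elim: (M - N)%N => [|n IH].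
  rewrite addn0 !rad_seriesE; apply: eq_int_comb => j; rewrite size_mkseq => jN.
  by rewrite /truncate jN.
rewrite addnS /rad_series [series _ (_ + _).+1]seriesSr -/(rad_series _ _) IH.
by rewrite /truncate ltnNge leq_addr scaler0 addr0.
Qed.

(** The form in which the RAD-norm is used: its square is the supremum of the energies. *)
Lemma RAD_norm_leP x c : 0 <= c ->
  (RAD_norm x <= c%:E)%E <-> forall N, energy N x <= c ^+ 2.
Proof.
move=> c0; have sE N : (Rad_norm (truncate x N) <= c%:E)%E = (energy N x <= c ^+ 2).
  rewrite Rad_norm_truncate lee_fin -[in LHS](ger0_norm c0) -sqrtr_sqr.
  by rewrite ler_sqrt// sqr_ge0.
split=> [xc N|xc].
  by rewrite -sE; apply: le_trans xc; apply: ereal_sup_ubound; exists N.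
by apply: ge_ereal_sup => _ [N _ <-]; rewrite sE.
Qed.

Lemma RAD_memP x : RAD_mem x -> exists2 c, 0 <= c & RAD_norm x = c%:E.
Proof.
rewrite /RAD_mem /=; have : (0 <= RAD_norm x)%E.
  apply: (@le_trans _ _ (Rad_norm (truncate x 0))); first exact: sqrte_ge0.
  by apply: ereal_sup_ubound; exists 0%N.
by case: (RAD_norm x) => // r r0 _; exists r.
Qed.

Definition osc_set x c m : set R :=
  [set t | I01 t /\ exists p q, [/\ (m <= p)%N, (p <= q)%N &
    c < rnorm (rad_series x t q - rad_series x t p)]].

Lemma measurable_osc_set x c m : measurable (osc_set x c m).
Proof.
rewrite (_ : osc_set x c m = I01 `&` \bigcup_(p in [set p | (m <= p)%N])
    \bigcup_(q in [set q | (p <= q)%N])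
      [set t | c < rnorm (rad_series x t q - rad_series x t p)]).
  apply: measurableI; first exact: measurable_itv.
  apply: bigcup_measurable => p _; apply: bigcup_measurable => q _.
  have := @measurable_rnorm_series setT x p q measurableT _ (measurable_itv `]c, +oo[).
  rewrite setTI; congr (measurable _).
  by apply/seteqP; split => t /=; rewrite in_itv/= andbT.
apply/seteqP; split => t /=.
  by case=> t01 [p [q [mp pq cpq]]]; split => //; exists p => //; exists q.
by case=> t01 [p mp [q pq cpq]]; split => //; exists p, q.
Qed.

(** The part of [0,1] where the series diverges. It is a Borel set, by the Cauchy criterion,
    so the limit, which takes a constant default value there, is measurable on [0,1]. *)
Definition divset x : set R := [set t | I01 t /\ ~ cvgn (rad_series x t)].

Lemma divsetE x : divset x = \bigcup_n \bigcap_m osc_set x n.+1%:R^-1 m.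
Proof.
apply/seteqP; split => t.
  case=> t01 ncv; apply: contrapT => H; apply: ncv.
  apply: rnorm_cauchy_cvg => e e0; apply: contrapT => He; apply: H.
  have [n _ ne] : exists2 n, True & n.+1%:R^-1 < e.
    exists (Num.bound e^-1) => //.
    rewrite -[e]invrK ltf_pV2 ?posrE ?invr_gt0//.
    have /archi_boundP/lt_le_trans : 0 <= e^-1 by rewrite invr_ge0 ltW.
    by apply; rewrite invrK ler_nat.
  exists n => // m _; split => //; apply: contrapT => Hm; apply: He; exists m => p q mp pq.
  by rewrite leNgt; apply/negP => epq; apply: Hm; exists p, q; split => //; exact: lt_trans epq.
case=> n _ H; split; first by have [] := H 0%N I.
move=> /cvg_rnorm_cauchy/(_ n.+1%:R^-1)[|m Hm]; first by rewrite invr_gt0.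
have [_ [p [q [mp pq]]]] := H m I.
by rewrite ltNge Hm// (leq_trans mp).
Qed.

Lemma measurable_divset x : measurable (divset x).
Proof.
rewrite divsetE; apply: bigcup_measurable => n _; apply: bigcap_measurable => // m _.
exact: measurable_osc_set.
Qed.

Lemma Rad_memP x : Rad_mem x <-> mu (divset x) = 0%E.
Proof.
have <- : mu.-negligible (divset x) <-> mu (divset x) = 0%E.
  by apply: negligibleP; exact: measurable_divset.
suff <- : ~` [set t : R | t \in `[0, 1] -> cvgn (rad_series x t)] = divset x by [].
apply/seteqP; split => t /=; first by move/not_implyP => [].
by case=> t01 ncv; apply/not_implyP.
Qed.

(** Almost sure convergence implies convergence in probability: the sets [osc_set x c m]
    decrease in [m] to a set of divergence points. *)
Lemma osc_set_small x c (e : R) : Rad_mem x -> 0 < c -> 0 < e ->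
  exists m, (mu (osc_set x c m) <= e%:E)%E.
Proof.
move=> /Rad_memP xR c0 e0.
have I1 : mu I01 = 1%E by rewrite /= lebesgue_measure_itv/= lte01 sube0.
have mI : measurable (\bigcap_m osc_set x c m).
  by apply: bigcap_measurable => // m _; exact: measurable_osc_set.
have cv : mu \o osc_set x c @ \oo --> mu (\bigcap_m osc_set x c m).
  apply: nonincreasing_cvg_mu => //.
  - rewrite (@le_lt_trans _ _ (mu I01))//; last by rewrite I1 ltry.
    apply: le_measure; rewrite ?inE; [exact: measurable_osc_set|exact: measurable_itv|].
    by move=> t [].
  - by move=> m; exact: measurable_osc_set.
  - move=> m n mn; apply/subsetPset => t [t01 [p [q [np pq h]]]]; split => //.
    by exists p, q; split => //; exact: leq_trans np.
have z : mu (\bigcap_m osc_set x c m) = 0%E.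
  apply: (subset_measure0 _ _ _ xR) => //; first exact: measurable_divset.
  move=> t H; split; first by have [] := H 0%N I.
  move=> /cvg_rnorm_cauchy/(_ c c0)[m Hm].
  have [_ [p [q [mp pq]]]] := H m I.
  by rewrite ltNge Hm// (leq_trans mp).
move: cv; rewrite z => /fine_cvgP[+ /cvgrPdist_le/(_ _ e0)].
move=> [a _ Ha] [b _ Hb]; exists (maxn a b).
have := Ha _ (leq_maxl a b); have := Hb _ (leq_maxr a b) => /=.
rewrite sub0r normrN => h fin; rewrite -(fineK fin) lee_fin.
exact: le_trans (ler_norm _) h.
Qed.

(** Convergence in probability of the series bounds ||S_N - S_n|| in probability by a
    small c with exceptional probability 1/8, and [energy_le_small] turns this into an L2
    bound. *)
Lemma energy_tail_small x (e : R) : Rad_mem x -> 0 < e ->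
  exists m, forall n N, (m <= n)%N -> (n <= N)%N -> energy N (tail n x) <= e.
Proof.
move=> xR e0; pose c := Num.sqrt (e / 8).
have e8 : 0 < e / 8 by rewrite divr_gt0.
have c0 : 0 < c by rewrite sqrtr_gt0.
have e18 : 0 < 1 / 8 :> R by rewrite divr_gt0.
have [m Hm] := @osc_set_small x c (1 / 8) xR c0 e18.
exists m => n N mn nN.
have -> : e = 8 * c ^+ 2 by rewrite sqr_sqrtr ?ltW// mulrC divfK.
apply: energy_le_small; first exact: ltW.
rewrite -lee_fin -integral_rad_word; last by move=> d; exact: ler0n.
apply: le_trans Hm.
pose A := [set t : R | c < rnorm (int_comb (rad_word t N) (tail n x))].
have mA : measurable A := measurable_rad_word (fun d => c < rnorm (int_comb d (tail n x))) N.
have -> : (\int[mu]_(t in I01) ((c < rnorm (int_comb (rad_word t N) (tail n x)))%R%:R)%:E =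
    \int[mu]_(t in I01) (\1_A t)%:E)%E.
  by apply: eq_integral => t _; rewrite indicE mem_setE.
rewrite integral_indic//.
apply: le_measure; rewrite ?inE.
- by apply: measurableI => //; exact: measurable_itv.
- exact: measurable_osc_set.
- move=> t [At t01]; split => //; exists n, N; split => //.
  by rewrite -rad_series_tail// rad_seriesE.
Qed.

Let cvg_set x := I01 `\` divset x.

Lemma cvg_setP x t : cvg_set x t -> cvgn (rad_series x t).
Proof. by case=> t01 nd; apply: contrapT => ncv; apply: nd. Qed.

Lemma measurable_cvg_set x : measurable (cvg_set x).
Proof. by apply: measurableD; [exact: measurable_itv|exact: measurable_divset]. Qed.

Lemma integral_cvg_set x (f : R -> \bar R) : Rad_mem x -> measurable_fun I01 f ->
  (forall t, I01 t -> 0 <= f t)%E ->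
  (\int[mu]_(t in I01) f t = \int[mu]_(t in cvg_set x) f t)%E.
Proof.
move=> /Rad_memP xR mf f0; apply: ge0_negligible_integral => //.
exact: measurable_divset.
Qed.

Lemma measurable_rnorm_lim x m :
  measurable_fun (cvg_set x) (fun t => rnorm (limn (rad_series x t) - rad_series x t m)).
Proof.
apply: (@measurable_fun_cvg _ _ _ _
  (fun N t => rnorm (rad_series x t N - rad_series x t m))).
  by move=> N; exact: measurable_rnorm_series.
move=> t /cvg_setP ct; apply: cvg_rnorm; apply: cvgB => //; exact: cvg_cst.
Qed.

(** Fatou's lemma along S_N - S_m, N -> oo. The case m = 0 bounds the limit itself. *)
Lemma Fatou_tail x m c : Rad_mem x ->
  (forall N, (m <= N)%N -> energy N (tail m x) <= c) ->
  (\int[mu]_(t in cvg_set x) (rnorm (limn (rad_series x t) - rad_series x t m) ^+ 2)%:E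
    <= c%:E)%E.
Proof.
move=> xR xc.
pose f N t := (rnorm (rad_series x t (N + m)%N - rad_series x t m) ^+ 2)%:E.
have mf D N : measurable_fun D (f N).
  by apply/measurable_EFinP/measurable_funX; exact: measurable_rnorm_series.
have f0 N t : (0 <= f N t)%E by rewrite lee_fin sqr_ge0.
have -> : (\int[mu]_(t in cvg_set x) (rnorm (limn (rad_series x t) - rad_series x t m) ^+ 2)%:E =
    \int[mu]_(t in cvg_set x) limn_einf (f ^~ t))%E.
  apply: eq_integral => t; rewrite inE => /cvg_setP ct.
  have ft : f ^~ t @ \oo --> (rnorm (limn (rad_series x t) - rad_series x t m) ^+ 2)%:E.
    apply: cvg_EFin; first by near=> N.
    rewrite (_ : _ \o _ =
      (fun n => rnorm (rad_series x t (n + m)%N - rad_series x t m) ^+ 2))//.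
    rewrite (@cvg_shiftn m _ (fun N => rnorm (rad_series x t N - rad_series x t m) ^+ 2)).
    have rc : (fun N => rnorm (rad_series x t N - rad_series x t m)) @ \oo -->
        rnorm (limn (rad_series x t) - rad_series x t m).
      by apply: cvg_rnorm; apply: cvgB => //; exact: cvg_cst.
    by rewrite expr2; exact: cvgM.
  by rewrite is_cvg_limn_einfE; [exact/esym/cvg_lim|apply/cvg_ex; eexists; exact: ft].
apply: (le_trans (@fatou _ _ _ mu (cvg_set x) (measurable_cvg_set x) f (mf _) (fun N t _ => f0 N t))).
rewrite limn_einf_lim; apply: lime_le; first exact: is_cvg_einfs.
near=> N; apply: (@le_trans _ _ (\int[mu]_(t in cvg_set x) f N t)%E).
  by apply: ereal_inf_lbound; exists N => /=.
rewrite -integral_cvg_set//.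
have -> : (\int[mu]_(t in I01) f N t =
    \int[mu]_(t in I01) (rnorm (rad_series (tail m x) t (N + m)%N) ^+ 2)%:E)%E.
  by apply: eq_integral => t _; rewrite /f rad_series_tail// leq_addl.
by rewrite integral_rad_series lee_fin xc// leq_addl.
Unshelve. all: by end_near. Qed.

(** Off the set of convergence the limit is the default point of [E]. *)
Lemma measurable_rnorm_lim01 x :
  measurable_fun I01 (fun t => rnorm (limn (rad_series x t))).
Proof.
have -> : I01 = cvg_set x `|` divset x.
  rewrite /cvg_set setDE; apply/seteqP; split => t /=.
    by move=> t01; have [d|nd] := pselect (divset x t); [right|left].
  by case=> -[].
apply/measurable_funU; [exact: measurable_cvg_set|exact: measurable_divset|split].
  have := @measurable_rnorm_lim x 0; apply: eq_measurable_fun => t _.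
  by rewrite /rad_series /series /= big_geq// subr0.
apply: (@eq_measurable_fun _ _ _ _ _ (cst (rnorm (point : E)))) => //.
by move=> t; rewrite inE => -[_ /dvgP ->].
Qed.

(** By monotonicity of the energies one may replace N by a large M; then S_M is close in L2
    to the limit S by [Fatou_tail] and the vanishing of the tails. *)
Lemma Rad_norm_ge_energy x N : Rad_mem x ->
  ((energy N x)%:E <=
   \int[mu]_(t in I01) (rnorm (limn (rad_series x t)) ^+ 2)%:E)%E.
Proof.
move=> xR; set J := (\int[mu]_(t in I01) _)%E.
have J0 : (0 <= J)%E by apply: integral_ge0 => t _; rewrite lee_fin sqr_ge0.
have mlim : measurable_fun I01 (fun t => (rnorm (limn (rad_series x t)) ^+ 2)%:E).
  by apply/measurable_EFinP/measurable_funX; exact: measurable_rnorm_lim01.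
have mlim_cvg := measurable_funS (measurable_itv _) (@subDsetl _ I01 (divset x)) mlim.
have JC : (J = \int[mu]_(t in cvg_set x) (rnorm (limn (rad_series x t)) ^+ 2)%:E)%E.
  by apply: integral_cvg_set => // t _; rewrite lee_fin sqr_ge0.
(* From (a + b)^2 <= (1 + c) a^2 + (1 + 1/c) b^2, with a = ||S||, b = ||S - S_M|| and
   E b^2 <= c^2; then c -> 0. *)
have key c : 0 < c -> ((energy N x)%:E <= (1 + c)%:E * J + (c ^+ 2 + c)%:E)%E.
  move=> c0.
  have [m Hm] := energy_tail_small xR (exprn_gt0 2 c0).
  pose M := maxn m N.
  apply: (@le_trans _ _ (energy M x)%:E).
    by rewrite lee_fin energy_homo// leq_maxr.
  rewrite -integral_rad_series (@integral_cvg_set x)//; last 2 first.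
  - apply/measurable_EFinP/measurable_funX.
    have := @measurable_rnorm_series I01 x 0 M; apply: eq_measurable_fun => t _.
    by rewrite [rad_series x t 0]/rad_series /series /= big_geq// subr0.
  - by move=> t _; rewrite lee_fin sqr_ge0.
  pose g t := rnorm (limn (rad_series x t) - rad_series x t M) ^+ 2.
  have mg : measurable_fun (cvg_set x) (EFin \o g).
    by apply/measurable_EFinP/measurable_funX; exact: measurable_rnorm_lim.
  have g0 t : (0 <= (g t)%:E)%E by rewrite lee_fin sqr_ge0.
  have gI : (\int[mu]_(t in cvg_set x) (g t)%:E <= (c ^+ 2)%:E)%E.
    by apply: Fatou_tail => // n; apply: Hm; exact: leq_maxl.
  apply: (@le_trans _ _ (\int[mu]_(t in cvg_set x) ((1 + c)%:E *
    (rnorm (limn (rad_series x t)) ^+ 2)%:E + (1 + c^-1)%:E * (g t)%:E))%E).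
    apply: ge0_le_integral => //.
    - exact: measurable_cvg_set.
    - by move=> t _; rewrite lee_fin sqr_ge0.
    - apply/measurable_EFinP/measurable_funX.
      have := @measurable_rnorm_series (cvg_set x) x 0 M; apply: eq_measurable_fun => t _.
      by rewrite [rad_series x t 0]/rad_series /series /= big_geq// subr0.
    - by apply: emeasurable_funD; apply: measurable_funeM.
    - move=> t _; rewrite -!EFinM -EFinD lee_fin /g.
      have := rnormD (limn (rad_series x t)) (rad_series x t M - limn (rad_series x t)).
      rewrite addrC subrK [X in _ <= _ + X]rnormB.
      have := rnorm_ge0 (rad_series x t M).
      move: (rnorm (rad_series x t M)) (rnorm (limn _)) (rnorm (limn _ - _)) => s a b s0 sab.
      have /(le_trans) : s ^+ 2 <= (a + b) ^+ 2 by rewrite ler_sqr ?nnegrE; lra.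
      apply; rewrite -subr_ge0.
      rewrite (_ : _ - _ = c * (a - c^-1 * b) ^+ 2); first by rewrite mulr_ge0 ?sqr_ge0 ?ltW.
      by field; rewrite gt_eqF.
  rewrite ge0_integralD//; last 5 first.
  - exact: measurable_cvg_set.
  - by move=> t _; rewrite mule_ge0// lee_fin ?sqr_ge0// addr_ge0// ltW.
  - exact: measurable_funeM.
  - by move=> t _; rewrite mule_ge0// lee_fin addr_ge0// invr_ge0 ltW.
  - exact: measurable_funeM.
  rewrite !ge0_integralZl_EFin//; last 5 first.
  - exact: measurable_cvg_set.
  - by rewrite addr_ge0// invr_ge0 ltW.
  - exact: measurable_cvg_set.
  - by move=> t _; rewrite lee_fin sqr_ge0.
  - by rewrite addr_ge0// ltW.
  rewrite -JC leeD2l//.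
  apply: (@le_trans _ _ ((1 + c^-1)%:E * (c ^+ 2)%:E)%E).
    by rewrite lee_pmul2l// lte_fin addr_gt0// invr_gt0.
  by rewrite -EFinM lee_fin mulrDl mul1r expr2 mulrA mulVf ?gt_eqF// mul1r.
move: key J0; case: J {JC} => [J key J0| |] //; last by move=> _ _; exact: leey.
rewrite lee_fin in J0 *; rewrite leNgt; apply/negP => JN.
pose d := energy N x - J; have d0 : 0 < d by rewrite subr_gt0.
(* Small enough for c J + c^2 + c <= c (J + 2) <= d / 2. *)
pose c := d / (2 * (J + 2 + d)).
have D0 : 0 < 2 * (J + 2 + d) by lra.
have c0 : 0 < c by rewrite divr_gt0.
have cD : c * (2 * (J + 2 + d)) = d by rewrite /c divfK// gt_eqF.
have := key c c0; rewrite -EFinM -EFinD lee_fin.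
have dE : energy N x = J + d by rewrite /d addrC subrK.
have c1 : c < 1 by rewrite /c ltr_pdivrMr// mul1r; lra.
by rewrite dE; nra.
Qed.

Lemma energy_truncate x m N : (m <= N)%N -> energy N (truncate x m) = energy m x.
Proof.
move=> /subnK <-; rewrite addnC; elim: (N - m)%N => [|n IH].
  rewrite addn0; apply: eq_cube_avg => e me; congr (rnorm _ ^+ 2).
  by apply: eq_int_comb => j; rewrite (cube_size me) /truncate => ->.
rewrite addnS -IH /energy cube_avg_rcons; apply: eq_cube_avg => e me.
rewrite !int_comb_rcons (cube_size me) /truncate ltnNge leq_addr !mul0rz addr0.
by field.
Qed.

Lemma energyD_le x y N :
  energy N (fun j => x j + y j) <= 2 * energy N x + 2 * energy N y.
Proof.
rewrite /energy -!cube_avgZ -cube_avgD; apply: ler_cube_avg => e _; rewrite int_combD.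
have := rnormD (int_comb e x) (int_comb e y); have := rnorm_ge0 (int_comb e x + int_comb e y).
move: (rnorm (int_comb e x + _)) (rnorm (int_comb e x)) (rnorm (int_comb e y)) => s a b s0 sab.
have : s ^+ 2 <= (a + b) ^+ 2 by rewrite ler_sqr ?nnegrE; lra.
by have := sqr_ge0 (a - b); nra.
Qed.

(** Beyond some index the tail has energy at most 1. *)
Lemma energy_bounded x : Rad_mem x -> exists2 c, 0 <= c & forall N, energy N x <= c.
Proof.
move=> xR; have [m Hm] := energy_tail_small xR ltr01.
have E0 := energy_ge0 m x; exists (2 * energy m x + 2) => [|N]; first by lra.
apply: (@le_trans _ _ (energy (maxn m N) x)); first exact/energy_homo/leq_maxr.
set M := maxn m N; have mM : (m <= M)%N by exact: leq_maxl.
have -> : energy M x = energy M (fun j => truncate x m j + tail m x j).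
  congr energy; apply/funext => j; rewrite /truncate /tail.
  by case: leqP; rewrite ?addr0 ?add0r.
apply: (le_trans (energyD_le _ _ _)); rewrite energy_truncate//.
by have := Hm m M (leqnn m) mM; lra.
Qed.

(** The energies have the integral of ||S||^2 as an upper bound by [Rad_norm_ge_energy],
    and as least upper bound by Fatou's lemma. *)
Lemma RAD_norm_Rad x : Rad_mem x -> RAD_norm x = Rad_norm x.
Proof.
move=> xR; have [c c0 xc] := energy_bounded xR.
pose J := (\int[mu]_(t in I01) (rnorm (limn (rad_series x t)) ^+ 2)%:E)%E.
have J0 : (0 <= J)%E by apply: integral_ge0 => t _; rewrite lee_fin sqr_ge0.
have JC d : (forall N, energy N x <= d) -> (J <= d%:E)%E.
  move=> xd; rewrite /J (@integral_cvg_set x)//; last 2 first.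
  - by apply/measurable_EFinP/measurable_funX; exact: measurable_rnorm_lim01.
  - by move=> t _; rewrite lee_fin sqr_ge0.
  have -> : (\int[mu]_(t in cvg_set x) (rnorm (limn (rad_series x t)) ^+ 2)%:E =
     \int[mu]_(t in cvg_set x) (rnorm (limn (rad_series x t) - rad_series x t 0) ^+ 2)%:E)%E.
    by apply: eq_integral => t _; rewrite /rad_series /series /= big_geq// subr0.
  by apply: Fatou_tail => // N _; exact: xd.
have [j j0 JE] : exists2 j, 0 <= j & J = j%:E.
  move: (J) J0 (JC c xc) => [j| |] // j0 _.
  by exists j.
have Rj : Rad_norm x = (Num.sqrt j)%:E by rewrite /Rad_norm -/J JE.
apply/eqP; rewrite eq_le; apply/andP; split.
  rewrite Rj; apply/RAD_norm_leP; first exact: sqrtr_ge0.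
  by move=> N; rewrite sqr_sqrtr// -lee_fin -JE; exact: Rad_norm_ge_energy.
have [r r0 xr] : exists2 r, 0 <= r & RAD_norm x = r%:E.
  apply: RAD_memP; rewrite /RAD_mem /=.
  apply: (@le_lt_trans _ _ (Num.sqrt c)%:E); last exact: ltry.
  by apply/RAD_norm_leP; [exact: sqrtr_ge0|move=> N; rewrite sqr_sqrtr].
rewrite xr Rj lee_fin -(ger0_norm r0) -sqrtr_sqr ler_sqrt ?sqr_ge0// -lee_fin -JE.
by apply: JC; apply/RAD_norm_leP => //; rewrite xr.
Qed.

Lemma Rad_mem_RAD x : Rad_mem x -> RAD_mem x.
Proof.
move=> xR; have [c c0 xc] := energy_bounded xR.
rewrite /RAD_mem /=; apply: (@le_lt_trans _ _ (Num.sqrt c)%:E); last exact: ltry.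
by apply/RAD_norm_leP; [exact: sqrtr_ge0|move=> N; rewrite sqr_sqrtr].
Qed.

End RadEnergy.

(** * Multilinear maps: boundedness and averaging *)

Lemma cube_word_mul N e d : cube N e -> cube N d -> cube N (word_mul e d).
Proof.
elim: N e d => [|N IH] [|z e] [|w d] //; rewrite /word_mul /= !cube_cons.
move=> /andP[zs Ne] /andP[ws Nd]; rewrite IH// andbT.
by case/orP: zs => /eqP->; case/orP: ws => /eqP->.
Qed.

Section MultilinearMaps.
Context {R : realType} {k : scalars}.
Local Notation K := (scalar_field R k).
Variables (n : nat) (E : 'I_n -> banach R k) (F : banach R k).
Variable A : (forall i, E i) -> F.
Hypothesis Alin : multilinear A.
Implicit Types (y : forall i, E i) (x : forall i, nat -> E i).

Definition slot y i (u : E i) : F := A (dfwith y i u).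

Lemma slot_linear y i : linear (slot y (i := i)).
Proof. by move=> a u v; exact: Alin. Qed.

Definition slot_lin y i : {linear E i -> F} := HB.pack (slot y (i := i))
  (GRing.isLinear.Build K (E i) F *:%R (slot y (i := i)) (slot_linear (i := i) y)).

Lemma slot_int_comb y i e (u : nat -> E i) :
  slot y (int_comb e u) = int_comb e (fun j => slot y (u j)).
Proof. exact: (raddf_int_comb (slot_lin y i)). Qed.

Lemma dfwith_id y i : dfwith y i (y i) = y.
Proof.
by apply: functional_extensionality_dep => j; case: dfwithP.
Qed.

Lemma multilinear0 y i : y i = 0 -> A y = 0.
Proof. by move=> y0; rewrite -(dfwith_id y i) y0; exact: (raddf0 (slot_lin y i)). Qed.

(** Proved for the scaling of a subset of the coordinates, which allows the induction to
    treat one coordinate at a time. *)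
Lemma multilinearZ (a : 'I_n -> K) y :
  A (fun i => a i *: y i) = (\prod_i a i) *: A y.
Proof.
suff H (s : seq 'I_n) : uniq s ->
    A (fun i => if i \in s then a i *: y i else y i) = (\prod_(i <- s) a i) *: A y.
  rewrite -[\prod_i _]/(\prod_(i <- index_enum _) a i) -H ?index_enum_uniq//.
  by congr A; apply: functional_extensionality_dep => i; rewrite mem_index_enum.
elim: s => [_|i s IH] /=; first by rewrite big_nil scale1r.
case/andP => is_ us; rewrite big_cons -scalerA -IH//.
set z := (fun i => if i \in s then a i *: y i else y i).
have -> : (fun j => if j \in i :: s then a j *: y j else y j) =
    dfwith z i (a i *: z i).
  apply: functional_extensionality_dep => j; case: dfwithP => [|j' ij].
    by rewrite mem_head /z (negbTE is_).
  by rewrite inE eq_sym (negbTE ij).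
by rewrite -[LHS]/(slot_lin z i _) linearZ /= /slot dfwith_id.
Qed.

End MultilinearMaps.

Section Bounded.
Context {R : realType} {k : scalars}.
Local Notation K := (scalar_field R k).
Variables (n : nat) (E : 'I_n -> banach R k) (F : banach R k).
Variable A : (forall i, E i) -> F.
Hypotheses (n0 : (0 < n)%N) (Alin : multilinear A).
Implicit Types (y : forall i, E i) (x : forall i, nat -> E i).

Lemma cvg_prod_topology (u : nat -> forall i, E i) (l : forall i, E i) :
  (forall i, (fun m => u m i) @ \oo --> l i) ->
  (u : nat -> prod_topology E) @ \oo --> (l : prod_topology E).
Proof.
move=> H.
apply/cvg_sup => i U; rewrite nbhsE => -[B [[C oC <-] Cl] BU].
have : nbhs (l i) C by exact: open_nbhs_nbhs (conj oC Cl).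
move=> /(H i) HC; change (\forall m \near \oo, U (u m)).
case: HC => N _ HN; exists N => // m Nm; apply: BU; exact: HN.
Qed.

(** If A were unbounded on the unit ball, there would be y_m in it with
    ||A y_m|| > (m+1)^n; then y_m / (m+1) tends to 0 although ||A (y_m / (m+1))|| >= 1. *)
Lemma continuous_op_norm : continuous (A : prod_topology E -> F) ->
  exists2 a, 0 <= a & op_norm A = a%:E.
Proof.
move=> cA; pose B := [set x : forall i, E i | forall i, rnorm (x i) <= 1].
have B0 : B (fun=> 0) by move=> i; rewrite rnorm0.
have A0 : A (fun=> 0) = 0 by exact: (multilinear0 Alin (i := Ordinal n0)).
have op0 : (0 <= op_norm A)%E.
  by apply: ereal_sup_ubound; exists (fun=> 0) => //; rewrite A0 rnorm0.
suff [a Ha] : exists a, forall y, B y -> rnorm (A y) <= a.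
  have : (op_norm A <= a%:E)%E.
    by apply: ge_ereal_sup => _ [y By <-]; rewrite lee_fin Ha.
  by case: (op_norm A) op0 => [b| |] // b0 _; exists b.
apply: contrapT => unb.
have H (m : nat) : exists y, B y /\ m.+1%:R ^+ n < rnorm (A y).
  apply: contrapT => Hm; apply: unb; exists (m.+1%:R ^+ n) => y By.
  by rewrite leNgt; apply/negP => Hy; apply: Hm; exists y.
have [y Hy] := choice H.
pose u m : forall i, E i := fun i => emb m.+1%:R^-1 *: y m i.
have m0 (m : nat) : 0 < m.+1%:R :> R by rewrite ltr0n.
have uA m : 1 <= rnorm (A (u m)).
  rewrite /u (multilinearZ Alin (fun=> emb m.+1%:R^-1)) -emb_prod prodr_const card_ord.
  rewrite rnormZ_emb; last by rewrite exprn_ge0// invr_ge0 ltW.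
  by rewrite exprVn ler_pdivlMl ?exprn_gt0// mulr1 ltW//; exact: (Hy m).2.
have u0 : (u : nat -> prod_topology E) @ \oo --> ((fun=> 0) : prod_topology E).
  apply: cvg_prod_topology => i; apply: rnorm_cvg => e e0.
  exists (Num.bound e^-1) => m me.
  rewrite sub0r rnormN rnormZ_emb; last by rewrite invr_ge0 ltW.
  rewrite ler_pdivrMl//; apply: (le_trans ((Hy m).1 i)); rewrite -ler_pdivrMr// mul1r.
  have /archi_boundP/ltW/le_trans : 0 <= e^-1 by rewrite invr_ge0 ltW.
  by apply; rewrite ler_nat (leq_trans me).
have : A \o u @ \oo --> A (fun=> 0) := cvg_comp _ _ u0 (cA _).
move=> /cvg_rnorm; rewrite A0 rnorm0 => /cvgrPdist_lt/(_ _ ltr01)[m _ /(_ m (leqnn m))] /=.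
by rewrite sub0r normrN ger0_norm ?rnorm_ge0// ltNge uA.
Qed.

Lemma op_norm_bound a : 0 <= a -> op_norm A = a%:E ->
  forall y, rnorm (A y) <= a * \prod_i rnorm (y i).
Proof.
move=> a0 aE y.
have [/existsP[i /eqP yi]|] := boolP [exists i, rnorm (y i) == 0].
  rewrite (multilinear0 Alin (rnorm_eq0 yi)) rnorm0 mulr_ge0// prodr_ge0// => j _.
  exact: rnorm_ge0.
rewrite negb_exists => /forallP yn.
have yp i : 0 < rnorm (y i) by rewrite lt_neqAle eq_sym yn rnorm_ge0.
have : rnorm (A (fun i => emb (rnorm (y i))^-1 *: y i)) <= a.
  rewrite -lee_fin -aE; apply: ereal_sup_ubound.
  exists (fun i => emb (rnorm (y i))^-1 *: y i) => // i.
  by rewrite rnormZ_emb ?invr_ge0 ?rnorm_ge0// mulVf.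
rewrite (multilinearZ Alin (fun i => emb (rnorm (y i))^-1)) -emb_prod prodfV.
have p0 : 0 < \prod_i rnorm (y i) by exact: prodr_gt0.
by rewrite rnormZ_emb; [rewrite ler_pdivrMl// mulrC|rewrite invr_ge0 ltW].
Qed.

End Bounded.

Section Averaging.
Context {R : realType} {k : scalars}.
Variables (n : nat) (E : 'I_n -> banach R k) (F : banach R k).
Variables (A : (forall i, E i) -> F) (a : R).
Hypotheses (n0 : (0 < n)%N) (Alin : multilinear A) (a0 : 0 <= a).
Hypothesis Abound : forall y, rnorm (A y) <= a * \prod_i rnorm (y i).
Implicit Types (y : forall i, E i) (x : forall i, nat -> E i).

Definition hybrid m x y (j : nat) : forall i, E i :=
  fun i => if (i < m)%N then x i j else y i.

Lemma prod_rnorm_dfwith y (P : pred 'I_n) i0 (v : E i0) : P i0 ->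
  \prod_(i | P i) rnorm (dfwith y i0 v i) =
  rnorm v * \prod_(i | P i && (i != i0)) rnorm (y i).
Proof.
move=> Pi0; rewrite (bigD1 i0)//= dfwithin; congr (_ * _).
by apply: eq_bigr => i /andP[_ ii0]; rewrite dfwithout// eq_sym.
Qed.

(** The averaging identity, one factor at a time. After [m] factors the remaining slots hold
    arbitrary fixed vectors, over which the bound must be uniform because the next step
    puts a random vector in slot [m]: the sum with signs e is the average over d of
    the previous one with signs e d, slot [m] being filled with sum_l d_l x_l. So the new
    bound [G'] is the convolution of [G] with the norm of that sum, and [le_convolution]
    turns the L2 bound into a uniform one from [m = 2] on. *)
Lemma averaging m x N : (0 < m)%N -> (m <= n)%N ->
  exists G : seq int -> R, [/\ forall e, 0 <= G e,
    cube_avg N (fun e => G e ^+ 2) <= \prod_(i < n | (i < m)%N) energy N (x i),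
    (1 < m)%N -> forall e, cube N e ->
      G e ^+ 2 <= \prod_(i < n | (i < m)%N) energy N (x i) &
    forall e y, cube N e -> rnorm (int_comb e (fun j => A (hybrid m x y j))) <=
      a * G e * \prod_(i < n | (m <= i)%N) rnorm (y i)].
Proof.
case: m => // m _; elim: m => [_|m IH mn].
  pose i0 := Ordinal n0.
  (* With one factor, linearity alone moves the signed sum inside A. *)
  have i0E (i : 'I_n) : (i < 1)%N = (i == i0) by rewrite -val_eqE /= ltnS leqn0.
  exists (fun e => rnorm (int_comb e (x i0))); split => //.
  - by move=> e; exact: rnorm_ge0.
  - by rewrite (eq_bigl _ _ i0E) big_pred1_eq.
  - move=> e y Ne.
    have -> : int_comb e (fun j => A (hybrid 1 x y j)) = A (dfwith y i0 (int_comb e (x i0))).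
      rewrite -[RHS]/(slot A y _) slot_int_comb//; apply: eq_int_comb => j _; congr A.
      apply: functional_extensionality_dep => i; rewrite /hybrid.
      by case: dfwithP => // i' ii'; rewrite i0E eq_sym (negbTE ii').
    apply: le_trans (Abound _) _; rewrite prod_rnorm_dfwith// mulrA.
    by rewrite (eq_bigl (fun i : 'I_n => (0 < i)%N))// => i; rewrite lt0n.
have [G [G0 G2 _ GA]] := IH (ltnW mn).
pose im := Ordinal mn.
pose G' e := cube_avg N (fun d => G (word_mul e d) * rnorm (int_comb d (x im))).
have prodE : \prod_(i < n | (i < m.+2)%N) energy N (x i) =
    \prod_(i < n | (i < m.+1)%N) energy N (x i) * energy N (x im).
  rewrite (bigD1 im)//= mulrC; congr (_ * _); apply: eq_bigl => i.
  by rewrite -val_eqE /= (ltnS i) leq_eqVlt; case: ltngtP.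
have G'2 e : cube N e -> G' e ^+ 2 <= \prod_(i < n | (i < m.+2)%N) energy N (x i).
  move=> Ne; rewrite prodE; apply: le_trans (le_convolution _ _ Ne) _.
  by rewrite ler_wpM2r// energy_ge0.
exists G'; split.
- move=> e; apply: cube_avg_ge0 => d _; rewrite mulr_ge0// rnorm_ge0//.
- by rewrite -[leRHS](cube_avg_cst N); exact: ler_cube_avg.
- by move=> _.
- move=> e y Ne.
  set S := int_comb e _.
  have SE : S *+ 2 ^ N = cube_sum N (fun d => int_comb (word_mul e d)
      (fun j => A (hybrid m.+1 x (dfwith y im (int_comb d (x im))) j))).
    pose B j l := A (hybrid m.+1 x (dfwith y im (x im l)) j).
    have -> : S = int_comb e (fun j => B j j).
      apply: eq_int_comb => j _; congr A; apply: functional_extensionality_dep => i.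
      rewrite /hybrid; case: dfwithP => [|i' ii']; first by rewrite /= leqnn ltnn.
      have ne : (i' : nat) != m.+1 by rewrite -[m.+1]/(val im) val_eqE eq_sym.
      by rewrite [(i' < m.+2)%N]ltnS leq_eqVlt (negbTE ne).
    rewrite -cube_sum_orth//; apply: eq_cube_sum => d _; apply: eq_int_comb => j _.
    have hE v : hybrid m.+1 x (dfwith y im v) j = dfwith (hybrid m.+1 x y j) im v.
      apply: functional_extensionality_dep => i; rewrite /hybrid.
      case: (dfwithP (hybrid _ _ _ _)) => [|i' ii']; last by rewrite dfwithout.
      by rewrite dfwithin /= ltnn.
    rewrite hE -[RHS]/(slot A _ _) slot_int_comb//; apply: eq_int_comb => l _.
    by rewrite /B hE.
  have pE d : \prod_(i < n | (m < i)%N) rnorm (dfwith y im (int_comb d (x im)) i) =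
      rnorm (int_comb d (x im)) * \prod_(i < n | (m.+1 < i)%N) rnorm (y i).
    rewrite prod_rnorm_dfwith//=; congr (_ * _); apply: eq_bigl => i.
    by rewrite [RHS]ltn_neqAle -val_eqE /= eq_sym andbC.
  have SN : rnorm S <= cube_avg N (fun d => rnorm (int_comb (word_mul e d)
      (fun j => A (hybrid m.+1 x (dfwith y im (int_comb d (x im))) j)))).
    rewrite /cube_avg ler_pdivlMr ?exprn_gt0// mulrC -natrX mulr_natl -rnormMn SE.
    exact: rnorm_cube_sum.
  apply: (le_trans SN).
  rewrite mulrAC -cube_avgZ; apply: ler_cube_avg => d Nd.
  apply: le_trans (GA _ _ (cube_word_mul Ne Nd)) _.
  by rewrite pE [leRHS]mulrACA [X in _ <= _ * X]mulrC.
Qed.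

(** The case in which all slots are filled. *)
Lemma averaging_full x N : exists G : seq int -> R, [/\ forall e, 0 <= G e,
    cube_avg N (fun e => G e ^+ 2) <= \prod_i energy N (x i),
    (1 < n)%N -> forall e, cube N e -> G e ^+ 2 <= \prod_i energy N (x i) &
    forall e, cube N e -> rnorm (int_comb e (induced A x)) ^+ 2 <= a ^+ 2 * G e ^+ 2].
Proof.
have nE : \prod_(i < n | (i < n)%N) energy N (x i) = \prod_i energy N (x i).
  by apply: eq_bigl => i; rewrite ltn_ord.
have [G [G0 G2 Gn GA]] := averaging x N n0 (leqnn n).
rewrite nE in G2 Gn; exists G; split => // e Ne; rewrite -exprMn.
rewrite ler_sqr ?nnegrE ?rnorm_ge0 ?mulr_ge0//.
have := GA e (fun=> 0) Ne; rewrite big_pred0 ?mulr1; last first.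
  by move=> i; rewrite leqNgt ltn_ord.
congr (rnorm _ <= _); apply: eq_int_comb => j _; congr A.
by apply: functional_extensionality_dep => i; rewrite /hybrid ltn_ord.
Qed.

Lemma energy_induced x N :
  energy N (induced A x) <= a ^+ 2 * \prod_i energy N (x i).
Proof.
have [G [G0 G2 _ GA]] := averaging_full x N.
apply: le_trans (ler_wpM2l (sqr_ge0 a) G2).
by rewrite -cube_avgZ; apply: ler_cube_avg => e; exact: GA.
Qed.

Lemma rnorm_int_comb_induced x N e : (1 < n)%N -> cube N e ->
  rnorm (int_comb e (induced A x)) ^+ 2 <= a ^+ 2 * \prod_i energy N (x i).
Proof.
move=> n1 Ne; have [G [G0 _ Gn GA]] := averaging_full x N.
by apply: le_trans (GA e Ne) _; rewrite ler_wpM2l ?sqr_ge0// Gn.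
Qed.

End Averaging.

(** * Multilinear stability *)

Section RademacherSigns.
Variable R : realType.
Local Notation mu := (@lebesgue_measure R).

Lemma ae_mono (P Q : R -> Prop) : (forall t, P t -> Q t) ->
  {ae mu, forall t, P t} -> {ae mu, forall t, Q t}.
Proof. by move=> PQ; apply: negligibleS => t; exact/contra_not/PQ. Qed.

(** Dyadic points, where some Rademacher function vanishes, form a null set. *)
Lemma ae_rad_word_cube :
  {ae mu, forall t : R, t \in `[0, 1] -> forall N, cube N (rad_word t N)}.
Proof.
pose Z N := `[0, 1]%classic `&` [set t : R | ~ cube N (rad_word t N)].
have mA N : measurable [set t : R | ~ cube N (rad_word t N)].
  exact: (measurable_rad_word (fun c => ~ cube N c)).
have mZ N : measurable (Z N) by apply: measurableI => //; exact: measurable_itv.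
have Z0 N : mu (Z N) = 0%E.
  rewrite /Z setIC -integral_indic; [|exact: measurable_itv|exact: mA].
  transitivity (\int[mu]_(t in `[0%R, 1%R]) ((~~ cube N (rad_word t N))%:R)%:E)%E.
    apply: eq_integral => t _; rewrite indicE; congr (_%:R%:E); congr nat_of_bool.
    by apply/idP/idP; rewrite inE /= => /negP.
  rewrite (integral_rad_word N (F := fun c => (~~ cube N c)%:R)); last by move=> c; exact: ler0n.
  rewrite -[RHS](congr1 EFin (cube_avg_cst N 0)); congr EFin.
  by apply: eq_cube_avg => e Ne; rewrite Ne.
have : mu.-negligible (\bigcup_N Z N).
  by apply: negligible_bigcup => N; apply/negligibleP; [exact: mZ|exact: Z0].
apply: negligibleS => t /= /not_implyP[t01 /existsNP[N tN]].
by exists N.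
Qed.

End RademacherSigns.

Section Stability.
Context {R : realType} {k : scalars}.
Variables (n : nat) (E : 'I_n -> banach R k) (F : banach R k).
Variables (A : (forall i, E i) -> F) (a : R).
Hypotheses (n0 : (0 < n)%N) (Alin : multilinear A) (a0 : 0 <= a).
Hypothesis Abound : forall y, rnorm (A y) <= a * \prod_i rnorm (y i).
Implicit Types (y : forall i, E i) (x : forall i, nat -> E i).

Lemma induced_tail x p :
  tail p (induced A x) = induced A (fun i => tail p (x i)).
Proof.
apply/funext => j; rewrite /tail /induced; case: ifP => // _.
by rewrite (multilinear0 Alin (i := Ordinal n0)).
Qed.

Lemma rnorm_int_comb_unary x c : n = 1%N ->
  rnorm (int_comb c (induced A x)) <= a * rnorm (int_comb c (x (Ordinal n0))).
Proof.
move=> n1; set i0 := Ordinal n0.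
have i0E (i : 'I_n) : i = i0.
  by apply/val_inj => /=; move: (ltn_ord i); rewrite [X in (_ < X)%N]n1; case: (val i).
have -> : int_comb c (induced A x) = A (fun i => int_comb c (x i)).
  rewrite -(dfwith_id (fun i => int_comb c (x i)) i0) -[RHS]/(slot A _ _) slot_int_comb//.
  apply: eq_int_comb => j _; congr A; apply: functional_extensionality_dep => i.
  by rewrite (i0E i) dfwithin.
apply: le_trans (Abound _) _; rewrite (bigD1 i0)//= big_pred0 ?mulr1// => i.
by rewrite (i0E i) eqxx.
Qed.

(** For n >= 2 the tails of the image series are bounded, for almost every t, by the product
    of the tail energies of the factors; for n = 1 they are the images under A of tails of
    a convergent series. *)
Lemma Rad_mem_induced x :
  (forall i, Rad_mem (x i)) -> Rad_mem (induced A x).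
Proof.
move=> xR.
have [n1|n2] : n = 1%N \/ (1 < n)%N by case: (ltnP 1 n) => n1; [right|left; lia].
  move: (xR (Ordinal n0)); apply: ae_mono => t H t01; have {H} ct := H t01.
  apply: rnorm_cauchy_cvg => e e0.
  have e0' : 0 < e / (a + 1) by rewrite divr_gt0// ltr_wpDl.
  have [m Hm] := cvg_rnorm_cauchy ct e0'; exists m => p q mp pq.
  rewrite -rad_series_tail// induced_tail rad_seriesE.
  apply: le_trans (rnorm_int_comb_unary _ _ n1) _.
  rewrite -rad_seriesE rad_series_tail//.
  have := Hm p q mp (leq_trans mp pq); rewrite ler_pdivlMr ?ltr_wpDl//.
  have := rnorm_ge0 (rad_series (x (Ordinal n0)) t q - rad_series (x (Ordinal n0)) t p).
  by nra.
have := ae_rad_word_cube R; apply: ae_mono => t H t01; have {H} tc := H t01.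
apply: rnorm_cauchy_cvg => e e0.
(* With all n energies at most d <= 1, their product is at most d, as n > 0. *)
pose d := Num.min 1 (e ^+ 2 / (a ^+ 2 + 1)).
have a20 : 0 < a ^+ 2 + 1 by rewrite ltr_wpDl// sqr_ge0.
have d0 : 0 < d by rewrite lt_min ltr01 divr_gt0// exprn_gt0.
have d1 : d <= 1 by rewrite ge_min lexx.
have de : d * (a ^+ 2 + 1) <= e ^+ 2 by rewrite -ler_pdivlMr// ge_min lexx orbT.
have [m Hm] := choice (fun i => energy_tail_small (xR i) d0).
exists (\max_i m i) => p q mp pq.
rewrite -rad_series_tail// induced_tail rad_seriesE.
rewrite -ler_sqr ?nnegrE ?rnorm_ge0 ?(ltW e0)//.
apply: le_trans (rnorm_int_comb_induced n0 Alin a0 Abound _ n2 (tc q)) _.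
have Ed i : energy q (tail p (x i)) <= d.
  by apply: Hm => //; apply: leq_trans mp; exact: leq_bigmax.
have Pd : \prod_i energy q (tail p (x i)) <= d.
  rewrite (bigD1 (Ordinal n0))//= -[leRHS]mulr1; apply: ler_pM => //.
  - exact: energy_ge0.
  - by apply: prodr_ge0 => i _; exact: energy_ge0.
  - apply: Num.Theory.prodr_ile1 => i _; rewrite energy_ge0 /=; exact: le_trans (Ed i) d1.
have := ler_wpM2l (sqr_ge0 a) Pd; nra.
Qed.

Lemma RAD_norm_induced x (c : 'I_n -> R) :
  (forall i, 0 <= c i) -> (forall i, RAD_norm (x i) <= (c i)%:E)%E ->
  (RAD_norm (induced A x) <= (a * \prod_i c i)%:E)%E.
Proof.
move=> c0 xc; apply/RAD_norm_leP => [|N].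
  by rewrite mulr_ge0// prodr_ge0.
apply: le_trans (energy_induced n0 Alin a0 Abound _ _) _.
rewrite exprMn ler_wpM2l ?sqr_ge0// -prodrXl; apply: ler_prod => i _.
by rewrite energy_ge0 /=; apply: (RAD_norm_leP (x i) (c0 i)).1.
Qed.

End Stability.

Section Single.
Context {R : realType} {k : scalars}.

Definition single (E : banach R k) (v : E) : nat -> E := fun j => if j is 0%N then v else 0.

Lemma RAD_norm_single (E : banach R k) (v : E) : RAD_norm (single v) = (rnorm v)%:E.
Proof.
have E1 N : energy N.+1 (single v) = rnorm v ^+ 2.
  rewrite -[RHS](cube_avg_cst N.+1); apply: eq_cube_avg => -[|z e]//; rewrite cube_cons.
  by case/andP => z1 _; rewrite int_comb_cons int_comb0 addr0 rnorm_sign.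
apply/eqP; rewrite eq_le; apply/andP; split.
  apply/RAD_norm_leP => [|[|N]]; first exact: rnorm_ge0.
    by rewrite /energy cube_avg0 int_comb_nil rnorm0 expr0n /= sqr_ge0.
  by rewrite E1.
apply: (@le_trans _ _ (Rad_norm (truncate (single v) 1))).
  by rewrite Rad_norm_truncate E1 sqrtr_sqr ger0_norm// rnorm_ge0.
by apply: ereal_sup_ubound; exists 1%N.
Qed.

Lemma Rad_mem_single (E : banach R k) (v : E) : Rad_mem (single v).
Proof.
apply: aeW => t _; apply: rnorm_cauchy_cvg => e e0; exists 1%N => p q p1 pq.
have tail0 : tail p (single v) = fun=> 0.
  apply/funext => -[|j]; rewrite /tail; last by case: ifP.
  by rewrite leqNgt p1.
by rewrite -rad_series_tail// rad_seriesE tail0 int_comb0 rnorm0 ltW.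
Qed.

Lemma induced_single n (E : 'I_n -> banach R k) (F : banach R k)
    (A : (forall i, E i) -> F) (y : forall i, E i) :
  (0 < n)%N -> multilinear A ->
  induced A (fun i => single (y i)) = single (A y).
Proof.
move=> n0 Alin; apply/funext => -[|j] //.
by rewrite /induced (multilinear0 Alin (i := Ordinal n0)).
Qed.

End Single.

(** What the two sequence classes share: on members the norm is the RAD-norm, so both have
    the same norm estimates and only membership of the image sequence depends on the
    class. *)
Lemma stable_of_RAD_norm (R : realType) (k : scalars) (X : seq_rule R k) :
  (forall (E : banach R k) (x : nat -> E), seq_mem X x ->
     RAD_mem x /\ seq_norm X x = RAD_norm x) ->
  (forall (E : banach R k) (v : E), seq_mem X (single v)) ->
  (forall n (E : 'I_n -> banach R k) (F : banach R k) (A : (forall i, E i) -> F) a,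
     (0 < n)%N -> multilinear A -> 0 <= a ->
     (forall y, rnorm (A y) <= a * \prod_i rnorm (y i)) ->
     forall x : forall i, nat -> E i, (forall i, seq_mem X (x i)) ->
       seq_mem X (induced A x)) ->
  multilinearly_stable X.
Proof.
move=> XR Xs XA n E F A n0 [Alin Acont].
have [a a0 aE] := continuous_op_norm n0 Alin Acont.
have Ab := op_norm_bound Alin a0 aE.
have Amem x := XA n E F A a n0 Alin a0 Ab x.
split=> //; apply/eqP; rewrite eq_le; apply/andP; split.
  apply: ge_ereal_sup => _ [x xX <-].
  have [_ ->] := XR _ _ (Amem x (fun i => (xX i).1)).
  have p1 : \prod_(i < n) (1 : R) = 1 by rewrite big1.
  rewrite aE -[a]mulr1 -p1.
  apply: (RAD_norm_induced n0 Alin a0 Ab) => i //.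
  by have [xi x1] := xX i; have [_ <-] := XR _ _ xi.
apply: ge_ereal_sup => _ [y y1 <-].
apply: ereal_sup_ubound; exists (fun i => single (y i)).
  move=> i; split; first exact: Xs.
  by have [_ ->] := XR _ _ (Xs _ (y i)); rewrite RAD_norm_single lee_fin.
rewrite induced_single//.
by have [_ ->] := XR _ _ (Xs _ (A y)); rewrite RAD_norm_single.
Qed.

Theorem theorem3p5 (R : realType) (k : scalars) :
  multilinearly_stable (Rad R k) /\ multilinearly_stable (RAD R k).
Proof.
split; apply: stable_of_RAD_norm => /=.
- by move=> E x xR; split; [exact: Rad_mem_RAD|rewrite RAD_norm_Rad].
- by move=> E v; exact: Rad_mem_single.
- by move=> n E F A a n0 Alin a0 Ab x; exact: (Rad_mem_induced n0 Alin a0 Ab).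
- by move=> E x xR; split.
- by move=> E v; apply: Rad_mem_RAD; exact: Rad_mem_single.
- move=> n E F A a n0 Alin a0 Ab x xR.
  have [c Hc] := choice (fun i => let: ex_intro2 c c0 xc := RAD_memP (xR i) in
     ex_intro (fun c => 0 <= c /\ RAD_norm (x i) = c%:E) c (conj c0 xc)).
  rewrite /RAD_mem /=; apply: (@le_lt_trans _ _ (a * \prod_i c i)%:E); last exact: ltry.
  by apply: (RAD_norm_induced n0 Alin a0 Ab) => i; [exact: (Hc i).1|rewrite (Hc i).2].
Qed.
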